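(* Let $b\in(0,1)$ be fixed. Let $\Pi$ be a prior on $(f,\sigma^2)$ of product form $\Pi_f\otimes\pi_{\sigma^2}$, with $$\pi_{\sigma^2}=\pi_{\sigma^2,n}=\mathrm{Gamma}\Big(\Big\{\frac{1-b}{2}\Big\}n+1,\ b\Big).$$ Let $f_0$ be a bounded function and $\sigma_0^2>0$. Suppose, for some rate $\varepsilon_n=o(1)$ with $n\varepsilon_n^2\to\infty$ and a constant $D>0$, that $$\Pi_f\big[\|f-f_0\|_\infty\le\varepsilon_n\big]\ge e^{-Dn\varepsilon_n^2}.$$ Then, for a constant $M>0$ large enough, as $n\to\infty$, for $D_b$ the $b$-Rényi divergence, the marginal posterior distribution on $f$ verifies $$E_{f_0,\sigma_0^2}\Pi\big[D_b(p_{f,2\sigma_0^2},p_{f_0,2\sigma_0^2})\le M\varepsilon_n^2\mid(X,Y)\big]\to1 .$$ If moreover $\Pi[\|f\|_\infty\le K\mid(X,Y)]=1+o(1)$ (in probability under the true law) for some fixed constant $K>0$, then also $$E_{f_0,\sigma_0^2}\Pi\big[\|f-f_0\|_{L^2(\mu)}^2\le M\varepsilon_n^2\mid(X,Y)\big]\to1 .$$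
   Context: Model: one observes an i.i.d. sample $(X,Y)=(X_i,Y_i)_{1\le i\le n}$ with $Y_i=f(X_i)+\sigma\eta_i$, $X_i\sim\mu$ a probability measure on $[-1,1]^d$, $\eta_i\sim\mathcal{N}(0,1)$ independent of $X_i$; both $f:[-1,1]^d\to\mathbb{R}$ and $\sigma^2>0$ are unknown. $p_{f,\sigma^2}$ denotes the density of one observation $(X_1,Y_1)$, $p_{f,\sigma^2}(x,y)=(2\pi\sigma^2)^{-1/2}e^{-(y-f(x))^2/(2\sigma^2)}$ with respect to $\mu\otimes\mathrm{Lebesgue}$. $E_{f_0,\sigma_0^2}$ is expectation when the true parameters are $(f_0,\sigma_0^2)$. $\Pi[\cdot\mid(X,Y)]$ is the usual (Bayes) posterior distribution of $(f,\sigma^2)$, and for events depending on $f$ only it denotes the marginal posterior, $\Pi[f\in\cdot,\sigma^2\in\mathbb{R}^+\mid(X,Y)]$. $\mathrm{Gamma}(a_1,a_2)$ has density proportional to $x^{a_1-1}e^{-a_2x}$ on $(0,\infty)$. For $0<\alpha<1$ the Rényi divergence of order $\alpha$ between densities $f,g$ with respect to a measure $\Lambda$ is $D_\alpha(f,g)=-\frac1{1-\alpha}\log\int f^\alpha g^{1-\alpha}d\Lambda$. $\|h\|_{L^2(\mu)}^2=\int h^2d\mu$. *)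

(* Defs.v *)
From HB Require Import structures.
From mathcomp Require Import all_boot all_order all_algebra.
From mathcomp Require Import all_classical all_reals all_analysis.

Set Implicit Arguments.
Unset Strict Implicit.
Unset Printing Implicit Defensive.

Import Order.TTheory GRing.Theory Num.Theory.
Import numFieldNormedType.Exports.

Local Open Scope classical_set_scope.
Local Open Scope ring_scope.

Section Cube.
Variables (R : realType) (d : nat).

Definition cube_points : Type :=
  {x : d.-tuple R | [forall i, -1 <= tnth x i <= 1]}.

HB.instance Definition _ := Choice.on cube_points.

Lemma cube_center_subproof :
  [forall i, -1 <= tnth [tuple of nseq d (0 : R)] i <= 1].
Proof.
by apply/forallP => i; rewrite tnth_nseq lerN10 ler01.
Qed.

HB.instance Definition _ := isPointed.Build cube_points
  (exist _ [tuple of nseq d (0 : R)] cube_center_subproof).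

(* [-1, 1]^d with the trace of the Borel (product) sigma-algebra of R^d. *)
Definition cube : Type :=
  g_sigma_algebra_preimageType (fun x : cube_points => val x).

HB.instance Definition _ := Measurable.copy cube
  (g_sigma_algebra_preimageType (fun x : cube_points => val x)).

End Cube.

Definition supnorm (R : realType) (T : Type) (h : T -> R) : \bar R :=
  ereal_sup [set `|h x|%:E | x in [set: T]].

Definition L2normsq (R : realType) d (T : measurableType d)
    (mu : {measure set T -> \bar R}) (h : T -> R) : \bar R :=
  (\int[mu]_x ((h x) ^+ 2)%:E)%E.

(* Values in the extended reals: it is +oo when f and g are mutually singular. *)
Definition renyi_divergence (R : realType) d (T : measurableType d)
    (Lambda : {measure set T -> \bar R}) (alpha : R) (f g : T -> R) : \bar R :=
  (- (1 - alpha)^-1%:E *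
     lne (\int[Lambda]_x (f x `^ alpha * g x `^ (1 - alpha))%:E))%E.

(* The constant [c] is forced to be the inverse of the integral of
   x ^ (a1 - 1) e ^ (- a2 x), since [P] has total mass 1. *)
Definition is_Gamma (R : realType) (a1 a2 : R)
    (P : probability (measurableTypeR R) R) : Prop :=
  exists2 c : R, 0 < c & forall A, measurable A ->
    P A = (\int[lebesgue_measure]_(x in A `&` [set x | (0 < x)%R])
             (c * (x `^ (a1 - 1) * expR (- (a2 * x))))%:E)%E.

Section Regression.
Variables (R : realType) (d : nat).

(* The second parameter [v] is the variance; the density is 0 if v <= 0. *)
Definition obs_density (f : cube R d -> R) (v : R)
    (z : cube R d * measurableTypeR R) : R :=
  (Num.sqrt (2 * pi * v))^-1 * expR (- (z.2 - f z.1) ^+ 2 / (2 * v)).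

Definition obs_renyi (mu : probability (cube R d) R) (alpha : R)
    (f : cube R d -> R) (v : R) (g : cube R d -> R) (w : R) : \bar R :=
  renyi_divergence (mu \x (@lebesgue_measure R))%E alpha
    (obs_density f v) (obs_density g w).

End Regression.

Section Independence.
Variables (R : realType) (dO : measure_display) (Omega : measurableType dO).
Variable P : probability Omega R.

Definition indep_pair d1 d2 (T1 : measurableType d1) (T2 : measurableType d2)
    (X : Omega -> T1) (Y : Omega -> T2) : Prop :=
  forall A B, measurable A -> measurable B ->
    P (X @^-1` A `&` Y @^-1` B) = (P (X @^-1` A) * P (Y @^-1` B))%E.

Definition mutual_indep d1 (T : measurableType d1) (Z : nat -> Omega -> T)
    : Prop :=
  forall (s : seq nat) (A : nat -> set T), uniq s ->
    (forall i, measurable (A i)) ->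
    P (\bigcap_(i in [set` s]) Z i @^-1` A i) =
    (\prod_(i <- s) P (Z i @^-1` A i))%E.

(* Random design points and standard Gaussian noises of the model. *)
Definition iid_design_noise d (mu : probability (cube R d) R)
    (X : {mfun Omega >-> cube R d} ^nat)
    (eta : {mfun Omega >-> measurableTypeR R} ^nat) : Prop :=
  [/\ forall i A, measurable A -> distribution P (X i) A = mu A,
      forall i A, measurable A -> distribution P (eta i) A = normal_prob 0 1 A,
      forall i, indep_pair (X i) (eta i) &
      mutual_indep (fun i w => (X i w, eta i w))].

End Independence.

(* The observations (X_i, Y_i), i < n, with Y_i = f(X_i) + sqrt(v) eta_i. *)
Definition sample (R : realType) (d : nat) (Omega : Type)
    (X : nat -> Omega -> cube R d) (eta : nat -> Omega -> R)
    (f : cube R d -> R) (v : R) (n : nat) (w : Omega)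
    : n.-tuple (cube R d * measurableTypeR R) :=
  [tuple (X i w, f (X i w) + Num.sqrt v * eta i w) | i < n].

(* Posterior mass of [B] given the data [s], by Bayes' formula, for a prior
   [Pi] on [W] and a model with densities [p w].  In case the evidence is 0
   or +oo the value is 0 by convention. *)
Definition posterior (R : realType) d (W : measurableType d) (T : Type)
    (Pi : {measure set W -> \bar R}) (p : W -> T -> R)
    n (s : n.-tuple T) (B : set W) : R :=
  fine (\int[Pi]_(w in B) (\prod_(i < n) p w (tnth s i))%:E)%E /
  fine (\int[Pi]_w (\prod_(i < n) p w (tnth s i))%:E)%E.

(* A regression function is drawn from a prior through a random element [th]
   of a measurable space [Theta], the function attached to [th] being [F th].
   [A] is an event on [f] only, hence the marginal posterior of [A]. *)
Definition posterior_f (R : realType) (d : nat) dT (Theta : measurableType dT)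
    (F : Theta -> cube R d -> R)
    (Pif : probability Theta R) (pis : probability (measurableTypeR R) R)
    n (s : n.-tuple (cube R d * measurableTypeR R)) (A : set Theta) : R :=
  posterior (Pif \x pis)%E
    (fun w : Theta * measurableTypeR R => obs_density (F w.1) w.2) s
    (A `*` [set v | 0 < v]).

(* Main.v *)
Require Import Defs.
From HB Require Import structures.
From mathcomp Require Import all_boot all_order all_algebra.
From mathcomp Require Import all_classical all_reals all_analysis.
From mathcomp Require Import measurable_realfun.
From mathcomp Require Import ring lra.

(** The Gamma prior on the variance turns the posterior into a tempered one.
    Write a variance as [v = s0 u / b].  The factor [v ^ ((1 - b) n / 2)] of
    the prior density cancels a part of the normalising factor
    [v ^ (- n / 2)] of the likelihood, so that likelihood times prior density
    is, up to a factor depending on the data only, [exp (- b v)] times the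
    [b]-th power of the likelihood ratio between the parameters [(f, s0 u)]
    and the true ones [(f0, s0)] ([integral_likelihood_evidence]).  Posterior
    probabilities are therefore quotients of integrals of such powers, called
    [evidence] below.  Numerator and denominator are bounded separately; both
    bounds rest on independence ([expectation_prod_design_noise_le]) and on one
    Gaussian integral ([integral_tempered_ratio]), at the exponents [b] and
    [- b].

    Numerator.  The mean of the [b]-th power of the ratio over [n]
    observations is the [n]-th power of an overlap of two densities.  Its part
    depending on [u] decays like [exp (- c (u - 1) ^ 2)] near 1, and is bounded
    away from 1 elsewhere.  As long as [u (1 - b) + b <= 2], its part depending
    on [f] is at most the affinity of [f] and [f0] at variance [2 s0], which is
    the reason for the factor 2 in the statement.  Outside the Renyi ball of
    radius [M eps ^ 2] the mean evidence is thus at most of order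
    [n ^ (- 1 / 2) exp (- (1 - b) M n eps ^ 2) + exp (- c n)]
    ([expected_evidence_le]).

    Denominator.  On the product of the sup-norm ball around [f0] and of an
    interval of variances of length of order [n ^ (- 1 / 2)], the mean of the
    power [- b] of the ratio is at most of order [exp (C n eps ^ 2)].  With large
    probability the evidence is then at least of order
    [n ^ (- 1 / 2) exp (- C' n eps ^ 2)] ([evidence_lower]).

    The two factors [n ^ (- 1 / 2)] cancel ([evidence_balance]), which is why
    [n eps ^ 2] tending to infinity is enough, at no logarithmic cost.

    For the second assertion, on functions bounded by [K] the Renyi divergence
    dominates a multiple of the squared L2 distance ([L2normsq_le_renyi]). *)

Set Implicit Arguments.
Unset Strict Implicit.
Unset Printing Implicit Defensive.

Import Order.TTheory GRing.Theory Num.Theory.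
Import numFieldNormedType.Exports.

Local Open Scope classical_set_scope.
Local Open Scope ring_scope.

(** * Integrals weighted by a law *)

Section LawTransfer.
Local Open Scope ereal_scope.
Context d1 d2 (T1 : measurableType d1) (T2 : measurableType d2) (R : realType).
Variables (m : {measure set T1 -> \bar R}) (nu : {measure set T2 -> \bar R}).
Variables (D : set T1) (W : T1 -> R) (Z : T1 -> T2) (c : R).
Hypotheses (mD : measurable D) (mW : measurable_fun setT W)
  (W0 : forall x, (0 <= W x)%R) (mZ : measurable_fun setT Z).
Hypothesis lawW : forall A, measurable A ->
  \int[m]_(x in D `&` Z @^-1` A) (W x)%:E = c%:E * nu A.

Import HBNNSimple.

Let transfer_nnsfun (h : {nnsfun T2 >-> R}) :
  \int[m]_(x in D) ((W x)%:E * (h (Z x))%:E) = c%:E * \int[nu]_y (h y)%:E.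
Proof.
have mWD : measurable_fun D (fun x => (W x)%:E).
  by apply: measurable_funTS; exact/measurable_EFinP.
have mind r : measurable_fun D (fun x => (r * \1_(h @^-1` [set r]) (Z x))%:E).
  apply/measurable_EFinP/measurable_funM => //.
  apply: measurable_funTS; apply: (measurableT_comp _ mZ).
  exact: measurable_indic.
under [in RHS]eq_integral do rewrite fimfunE -fsumEFin//.
rewrite ge0_integral_fsum//; last 2 first.
- by move=> r; apply/measurable_EFinP/measurable_funM => //; exact: measurable_indic.
- by move=> r y _; exact: nnfun_muleindic_ge0.
transitivity (\int[m]_(x in D) \sum_(r \in range h)
    ((r * \1_(h @^-1` [set r]) (Z x))%:E * (W x)%:E)).
  apply: eq_integral => x _.
  rewrite -ge0_mule_fsuml => [|y]; last exact: nnfun_muleindic_ge0.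
  by rewrite fsumEFin// -fimfunE muleC.
rewrite ge0_integral_fsum//; last 2 first.
- by move=> r; exact: emeasurable_funM.
- move=> r x _; apply: mule_ge0; last by rewrite lee_fin.
  exact: nnfun_muleindic_ge0.
rewrite ge0_mule_fsumr => [|r]; last first.
  by apply: integral_ge0 => y _; exact: nnfun_muleindic_ge0.
apply: eq_fsbigr => r rh.
have mhr : measurable (h @^-1` [set r]) by exact: measurable_sfunP.
rewrite integralZl_indic_nnsfun// integral_indic// setIT.
under eq_integral do rewrite EFinM -muleA.
rewrite ge0_integralZl//; last 3 first.
- apply: emeasurable_funM => //; apply/measurable_EFinP/measurable_funTS.
  by apply: (measurableT_comp _ mZ); exact: measurable_indic.
- by move=> x _; rewrite mule_ge0 ?lee_fin.
- by move: rh; rewrite inE => -[t _ <-]; rewrite lee_fin.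
rewrite muleCA -lawW//; congr (_ * _).
rewrite integral_mkcondr; apply: eq_integral => x _.
by rewrite epatch_indic/= muleC.
Qed.

(** Both sides are continuous along increasing sequences, which reduces the
    claim to simple functions.  With [Z] the identity this is integration
    against a density; with [W] a function independent of [Z] it is the product
    rule for expectations. *)
Lemma ge0_integral_weighted_law (g : T2 -> \bar R) :
  measurable_fun setT g -> (forall y, 0 <= g y) ->
  \int[m]_(x in D) ((W x)%:E * g (Z x)) = c%:E * \int[nu]_y g y.
Proof.
move=> mg g0; pose h := nnsfun_approx measurableT mg.
have hg y : (h n y)%:E @[n --> \oo] --> g y by exact: cvg_nnsfun_approx.
have ndh y : {homo (fun n => (h n y)%:E) : a b / (a <= b)%N >-> a <= b}.
  by move=> a b ab; rewrite lee_fin; exact/lefP/nd_nnsfun_approx.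
have -> : \int[nu]_y g y = limn (fun n => \int[nu]_y (h n y)%:E).
  rewrite -monotone_convergence//.
  - by apply: eq_integral => y _; apply/esym/cvg_lim.
  - by move=> n; exact/measurable_EFinP.
  - by move=> n y _; rewrite lee_fin.
have -> : \int[m]_(x in D) ((W x)%:E * g (Z x)) =
    limn (fun n => \int[m]_(x in D) ((W x)%:E * (h n (Z x))%:E)).
  rewrite -monotone_convergence//.
  - by apply: eq_integral => x _; apply/esym/cvg_lim => //; exact: cvgeZl.
  - move=> n; apply/measurable_EFinP/measurable_funTS/measurable_funM => //.
    exact: measurableT_comp.
  - by move=> n x _; rewrite mule_ge0 ?lee_fin.
  - by move=> x _ a b ab; apply: lee_wpmul2l; rewrite ?lee_fin//; exact: ndh.
under eq_fun do rewrite transfer_nnsfun.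
apply/cvg_lim => //; apply: cvgeZl => //; apply: ereal_nondecreasing_is_cvgn => a b ab.
apply: ge0_le_integral => //; try by move=> *; rewrite lee_fin.
all: try exact/measurable_EFinP.
by move=> y _; exact: ndh.
Qed.

End LawTransfer.
(** * Products of independent variables *)

Section IndependentProducts.
Local Open Scope ereal_scope.
Context dO dT (Omega : measurableType dO) (T : measurableType dT) (R : realType).
Variables (P : probability Omega R) (nu : probability T R).
Variable Z : nat -> Omega -> T.
Hypotheses (mZ : forall i, measurable_fun setT (Z i))
  (lawZ : forall i A, measurable A -> P (Z i @^-1` A) = nu A)
  (indZ : mutual_indep P Z).

Let mcap (s : seq nat) (A : nat -> set T) : (forall i, measurable (A i)) ->
  measurable (\bigcap_(i in [set` s]) Z i @^-1` A i).
Proof.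
move=> mA; rewrite bigcap_seq; apply: bigsetI_measurable => i _.
by rewrite -[_ @^-1` _]setTI; exact: mZ.
Qed.

(** Independence is given on events.  Carrying an event over [s2] along with
    the product over [s1] lets an induction move one index at a time from the
    event to the product: for each event in the moved coordinate, the
    induction hypothesis says that the other factors weight the law of that
    coordinate by a constant. *)
Lemma integral_prod_indep_on (g : nat -> T -> R) (I : nat -> R) :
  (forall i, measurable_fun setT (g i)) -> (forall i x, (0 <= g i x)%R) ->
  (forall i, \int[nu]_x (g i x)%:E = (I i)%:E) ->
  forall (s1 s2 : seq nat) (A : nat -> set T), uniq (s1 ++ s2) ->
  (forall i, measurable (A i)) ->
  \int[P]_(w in \bigcap_(i in [set` s2]) Z i @^-1` A i)
      (\prod_(i <- s1) g i (Z i w))%:E =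
  (\prod_(i <- s1) I i * \prod_(i <- s2) fine (nu (A i)))%:E.
Proof.
move=> mg g0 gI; elim=> [|x s1 IH] s2 A /= us mA.
  under eq_integral do rewrite big_nil.
  rewrite integral_cst//; last exact: mcap.
  rewrite mul1e big_nil mul1r -prodEFin [LHS](indZ us mA); apply: eq_bigr => i _.
  by rewrite lawZ// fineK// fin_num_measure.
have I0 i : (0 <= I i)%R.
  by rewrite -lee_fin -gI; apply: integral_ge0 => y _; rewrite lee_fin.
move: us => /andP[]; rewrite mem_cat negb_or => /andP[xs1 xs2] us.
under eq_integral do rewrite big_cons EFinM muleC.
have mprod : measurable_fun setT (fun w => \prod_(i <- s1) g i (Z i w))%R.
  by apply: measurable_prod => i _; exact: measurableT_comp.
(* weight: the product over s1 on the cylinder event; law: that of Z x *)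
rewrite (@ge0_integral_weighted_law _ _ _ _ _ P nu _
  (fun w => \prod_(i <- s1) g i (Z i w))%R (Z x)
  (\prod_(i <- s1) I i * \prod_(i <- s2) fine (nu (A i)))
  (mcap s2 mA) mprod _ (mZ x) _ (fun y => (g x y)%:E)); first 1 last.
- by move=> w; exact: prodr_ge0.
- move=> B mB; pose A' i := if i == x then B else A i.
  have mA' i : measurable (A' i) by rewrite /A'; case: ifP.
  have := IH (x :: s2) A'; rewrite big_cons.
  have -> : \bigcap_(i in [set` x :: s2]) Z i @^-1` A' i =
      (\bigcap_(i in [set` s2]) Z i @^-1` A i) `&` Z x @^-1` B.
    rewrite !bigcap_seq big_cons /A' eqxx setIC; congr (_ `&` _).
    by apply: eq_big_seq => i si; case: eqP => // ix; rewrite -ix si in xs2.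
  have -> : (\prod_(i <- s2) fine (nu (A' i)) =
             \prod_(i <- s2) fine (nu (A i)))%R.
    apply: eq_big_seq => i si; rewrite /A'.
    by case: eqP => // ix; rewrite -ix si in xs2.
  move=> -> //; last first.
    by rewrite uniq_catC/= mem_cat negb_or xs1 xs2/= uniq_catC.
  rewrite /A' eqxx mulrCA mulrC EFinM; congr (_ * _).
  by rewrite fineK// fin_num_measure.
- exact/measurable_EFinP.
- by move=> y; rewrite lee_fin.
by rewrite gI -EFinM big_cons -!mulrA [in RHS]mulrC !mulrA.
Qed.

Lemma integral_prod_iid_le (g : T -> R) (B : R) (n : nat) :
  measurable_fun setT g -> (forall x, (0 <= g x)%R) ->
  \int[nu]_x (g x)%:E <= B%:E ->
  \int[P]_w (\prod_(i < n) g (Z i w))%:E <= (B ^+ n)%:E.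
Proof.
move=> mg g0 gB.
have gfin : \int[nu]_x (g x)%:E \is a fin_num.
  rewrite ge0_fin_numE; first exact: le_lt_trans gB (ltry _).
  by apply: integral_ge0 => x _; rewrite lee_fin.
have := @integral_prod_indep_on (fun=> g) (fun=> fine (\int[nu]_x (g x)%:E))
  (fun=> mg) (fun=> g0) (fun=> esym (fineK gfin)) (index_iota 0 n) [::] (fun=> setT).
rewrite cats0 bigcap_seq !big_nil mulr1.
move=> /(_ (iota_uniq _ _) (fun=> measurableT)).
under eq_integral do rewrite big_mkord.
move=> ->; rewrite lee_fin big_mkord prodr_const.
have i0 : 0 <= \int[nu]_x (g x)%:E.
  by apply: integral_ge0 => x _; rewrite lee_fin.
rewrite card_ord; apply: lerXn2r.
- by rewrite nnegrE fine_ge0.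
- by rewrite nnegrE -lee_fin; exact: le_trans gB.
- by rewrite -lee_fin fineK.
Qed.

End IndependentProducts.
(** * Tonelli on subsets, integrals against densities *)

Section TonelliOnSubset.
Local Open Scope ereal_scope.
Context d1 d2 (T1 : measurableType d1) (T2 : measurableType d2) (R : realType).
Variables (m1 : {sigma_finite_measure set T1 -> \bar R})
  (m2 : {sigma_finite_measure set T2 -> \bar R}).
Variables (f : T1 * T2 -> \bar R) (D : set T2).
Hypotheses (mf : measurable_fun setT f) (f0 : forall z, 0 <= f z)
  (mD : measurable D).

Let mfD : measurable_fun setT (f \_ (setT `*` D)).
Proof.
apply/(measurable_restrictT f (measurableX measurableT mD)).
exact: measurable_funTS.
Qed.

Let fD0 z : 0 <= (f \_ (setT `*` D)) z.
Proof. by rewrite patchE; case: ifP. Qed.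

Let restrictE x :
  (fun y => f (x, y)) \_ D = (fun y => (f \_ (setT `*` D)) (x, y)).
Proof.
apply/funext => y; rewrite !patchE.
suff -> : (x, y) \in (setT `*` D) = (y \in D) by [].
by apply/idP/idP; rewrite !inE => // -[].
Qed.

Lemma measurable_fun_integral_on :
  measurable_fun setT (fun x => \int[m2]_(y in D) f (x, y)).
Proof.
under eq_fun do rewrite integral_mkcond restrictE.
exact: measurable_fun_fubini_tonelli_F.
Qed.

Lemma measurable_fun_integral_fst :
  measurable_fun setT (fun y => \int[m1]_x f (x, y)).
Proof. exact: measurable_fun_fubini_tonelli_G. Qed.

Lemma fubini_tonelli_on :
  \int[m1]_x \int[m2]_(y in D) f (x, y) =
  \int[m2]_(y in D) \int[m1]_x f (x, y).
Proof.
under eq_integral do rewrite integral_mkcond restrictE.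
rewrite (fubini_tonelli _ mfD fD0) [RHS]integral_mkcond; apply: eq_integral => y _.
rewrite patchE; case: ifPn => yD.
  apply: eq_integral => x _; rewrite patchE ifT//.
  by rewrite inE; split => //; exact/set_mem.
apply: integral0_eq => x _; rewrite patchE ifF//; apply/negbTE.
by apply: contra yD; rewrite !inE => -[].
Qed.

End TonelliOnSubset.

Section DensityIntegrals.
Local Open Scope ereal_scope.
Context (R : realType).

Lemma ge0_integral_density (Q : {measure set (measurableTypeR R) -> \bar R})
    (D : set (measurableTypeR R)) (W : measurableTypeR R -> R)
    (g : measurableTypeR R -> \bar R) :
  measurable D -> measurable_fun setT W -> (forall x, 0 <= W x)%R ->
  (forall A, measurable A ->
     Q A = \int[lebesgue_measure]_(x in A `&` D) (W x)%:E) ->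
  measurable_fun setT g -> (forall x, 0 <= g x) ->
  \int[Q]_x g x = \int[lebesgue_measure]_(x in D) (g x * (W x)%:E).
Proof.
move=> mD mW W0 QW mg g0.
rewrite -[LHS]mul1e -(@ge0_integral_weighted_law _ _ _ _ _ lebesgue_measure Q D
  W id 1 mD mW W0 (@measurable_id _ _ _) _ g mg g0).
  by apply: eq_integral => x _; rewrite muleC.
by move=> A mA; rewrite mul1e QW// setIC.
Qed.

Lemma integral_normal_prob (m s : R) (g : measurableTypeR R -> \bar R) :
  measurable_fun setT g -> (forall x, 0 <= g x) ->
  \int[normal_prob m s]_x g x =
  \int[lebesgue_measure]_x (g x * (normal_pdf m s x)%:E).
Proof.
move=> mg g0; apply: ge0_integral_density => //.
- exact: measurable_normal_pdf.
- by move=> x; exact: normal_pdf_ge0.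
- by move=> A mA; rewrite setIT.
Qed.

Lemma integral_Gamma (a1 a2 : R) (Q : probability (measurableTypeR R) R) :
  is_Gamma a1 a2 Q -> exists2 c : R, (0 < c)%R &
    forall g : measurableTypeR R -> \bar R,
    measurable_fun setT g -> (forall x, 0 <= g x) ->
    \int[Q]_x g x = \int[lebesgue_measure]_(x in [set x | (0 < x)%R])
      (g x * (c * (x `^ (a1 - 1) * expR (- (a2 * x))))%:E).
Proof.
move=> [c c0 Qc]; exists c => // g mg g0; apply: ge0_integral_density => //.
- by rewrite -set_itvoy; exact: measurable_itv.
- apply: measurable_funM => //; apply: measurable_funM => //.
  by apply: measurableT_comp => //; apply: measurableT_comp => //;
    exact: measurable_funM.
- by move=> x; rewrite mulr_ge0 ?(ltW c0)// mulr_ge0 ?powR_ge0 ?expR_ge0.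
Qed.

End DensityIntegrals.

Section DesignNoise.
Local Open Scope ereal_scope.
Context (R : realType) dX (TX : measurableType dX) (mu : probability TX R)
  (dO : measure_display) (Omega : measurableType dO) (P : probability Omega R)
  (X : {mfun Omega >-> TX} ^nat)
  (eta : {mfun Omega >-> measurableTypeR R} ^nat).
Hypotheses
  (lawX : forall i A, measurable A -> distribution P (X i) A = mu A)
  (lawe : forall i A, measurable A ->
     distribution P (eta i) A = normal_prob 0 1 A)
  (indXe : forall i, indep_pair P (X i) (eta i))
  (indZ : mutual_indep P (fun i w => (X i w, eta i w))).

Let mXeta i : measurable_fun setT (fun w => (X i w, eta i w)).
Proof. by apply/measurable_fun_pairP; split; exact: measurable_funP. Qed.

Let nu : probability (TX * measurableTypeR R)%type R :=
  (mu \x normal_prob 0 1)%E.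

Let law_design_noise i (A : set (TX * measurableTypeR R)) :
  measurable A -> P ((fun w => (X i w, eta i w)) @^-1` A) = nu A.
Proof.
move=> mA.
pose Z := mfun_Sub (mem_set (mXeta i)).
rewrite -[LHS]/(distribution P Z A) /nu; apply/esym.
apply: product_measure_unique => // B C mB mC.
transitivity (distribution P (X i) B * distribution P (eta i) C).
  exact: indXe.
by congr (_ * _); [exact: lawX|exact: lawe].
Qed.

Lemma expectation_prod_design_noise_le (phi : TX * measurableTypeR R -> R)
    (B : R) (n : nat) :
  measurable_fun setT phi -> (forall z, (0 <= phi z)%R) ->
  \int[mu]_x \int[normal_prob 0 1]_e (phi (x, e))%:E <= B%:E ->
  \int[P]_w (\prod_(i < n) phi (X i w, eta i w))%:E <= (B ^+ n)%:E.
Proof.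
move=> mphi phi0 phiB.
apply: (@integral_prod_iid_le _ _ _ _ _ P nu (fun i w => (X i w, eta i w))) => //.
- rewrite /nu fubini_tonelli1//; exact/measurable_EFinP.
Qed.

End DesignNoise.
(** * Powers of Gaussian likelihood ratios *)

Section GaussianRatio.
Context (R : realType).
Implicit Types a b u e k w p q y : R.

(** The [a]-th power of the ratio, at [e], of the densities of N(k, u) and
    N(0, 1). *)
Definition tempered_ratio a u k e : R :=
  expR (a * (e ^+ 2 / 2 - (e - k) ^+ 2 / (2 * u) - ln u / 2)).

Lemma tempered_ratio_gt0 a u k e : 0 < tempered_ratio a u k e.
Proof. exact: expR_gt0. Qed.

Lemma tempered_ratioN a u k e :
  tempered_ratio (- a) u k e = (tempered_ratio a u k e)^-1.
Proof. by rewrite /tempered_ratio mulNr expRN. Qed.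

Lemma sqrt_expR_ln u : 0 < u -> Num.sqrt u = expR (ln u / 2).
Proof. by move=> u0; rewrite -powR12_sqrt ?ltW// /powR gt_eqF// mulrC. Qed.

Lemma measurable_tempered_ratio a u k :
  measurable_fun setT (tempered_ratio a u k).
Proof.
apply: measurableT_comp => //; apply: measurable_funM => //.
apply: measurable_funB => //; apply: measurable_funB.
  by apply: measurable_funM => //; exact: measurable_funX.
apply: measurable_funM => //; apply: measurable_funX.
exact: measurable_funB.
Qed.

(** Completing the square: with [L = u (1 - a) + a], the integrand times the
    standard normal density is a multiple of the density of N(a k / L, u / L). *)
Lemma integral_tempered_ratio a u k : 0 < u -> 0 < u * (1 - a) + a ->
  (\int[normal_prob 0 1]_e (tempered_ratio a u k e)%:E =
   (expR (((1 - a) * ln u - ln (u * (1 - a) + a)) / 2 -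
          a * (1 - a) * k ^+ 2 / (2 * (u * (1 - a) + a))))%:E)%E.
Proof.
set L := u * (1 - a) + a => u0 L0.
rewrite integral_normal_prob; first last.
- by move=> x; rewrite lee_fin ltW// tempered_ratio_gt0.
- by apply/measurable_EFinP; exact: measurable_tempered_ratio.
set C := expR _.
pose s := Num.sqrt (u / L).
have uL0 : 0 < u / L by rewrite divr_gt0.
have s2 : s ^+ 2 = u / L by rewrite sqr_sqrtr// ltW.
have s0 : s != 0 by rewrite gt_eqF// sqrtr_gt0.
have peakE : normal_peak s = normal_peak 1 * expR (- ((ln u - ln L) / 2)).
  rewrite /normal_peak s2 expr1n mul1r -mulrnAr sqrtrM ?ltW// invfM mulrC.
  by rewrite (sqrt_expR_ln uL0) ln_div ?posrE// expRN.
transitivity (\int[lebesgue_measure]_x (C%:E * (normal_pdf (a * k / L) s x)%:E))%E.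
  apply: eq_integral => x _; rewrite -!EFinM; congr (_%:E).
  rewrite !normal_pdfE ?oner_neq0// peakE [LHS]mulrCA -[in RHS]mulrA [RHS]mulrCA.
  congr (_ * _); rewrite /C /tempered_ratio /normal_fun -!expRD; congr expR.
  rewrite s2 /L subr0; field.
  by rewrite -/L !gt_eqF.
rewrite ge0_integralZl//.
- by rewrite integral_normal_pdf mule1.
- by apply/measurable_EFinP; exact: measurable_normal_pdf.
- by move=> x _; rewrite lee_fin normal_pdf_ge0.
- by rewrite lee_fin expR_ge0.
Qed.

(** The exponential function lies above its tangent at the weighted mean. *)
Lemma weighted_expR_AMGM w p q : 0 <= w <= 1 ->
  expR (w * p + (1 - w) * q) <= w * expR p + (1 - w) * expR q.
Proof.
move=> /andP[w0 w1]; set m := w * p + _.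
have tan z : expR m * (1 + (z - m)) <= expR z.
  have -> : expR z = expR m * expR (z - m) by rewrite -expRD addrC subrK.
  by rewrite ler_wpM2l ?expR_ge0// expR_ge1Dx.
have -> : expR m = w * (expR m * (1 + (p - m))) +
    (1 - w) * (expR m * (1 + (q - m))) by rewrite /m; ring.
by rewrite lerD// ler_wpM2l// subr_ge0.
Qed.

(** Kober's refinement of the weighted inequality between arithmetic and
    geometric means of [x ^ 2] and [1], with [x = expR y].  Subtracting the
    square with the smaller of the two weights leaves a weighted mean again, of
    [x ^ 2] and [x] or of [x] and [1]. *)
Lemma Kober_expR b y : 0 < b < 1 ->
  expR (2 * (1 - b) * y) <=
  (1 - b) * expR y ^+ 2 + b - Num.min b (1 - b) * (expR y - 1) ^+ 2.
Proof.
move=> /andP[b0 b1]; have e2 : expR y ^+ 2 = expR (2 * y).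
  by rewrite expRM_natl.
set x := expR y in e2 *.
have [bh|bh] := leP b (1 - b).
  have w01 : 0 <= 1 - 2 * b <= 1 by lra.
  have := weighted_expR_AMGM (2 * y) y w01; rewrite -e2 -/x.
  have -> : (1 - 2 * b) * (2 * y) + (1 - (1 - 2 * b)) * y = 2 * (1 - b) * y.
    by ring.
  by move/le_trans; apply; rewrite le_eqVlt; apply/orP; left; apply/eqP; ring.
have w01 : 0 <= 2 * (1 - b) <= 1 by lra.
have := weighted_expR_AMGM y 0 w01; rewrite expR0 mulr0 addr0 -/x.
by move/le_trans; apply; rewrite le_eqVlt; apply/orP; left; apply/eqP; ring.
Qed.

(** Twice the logarithm of the mean [b]-th power ratio at [k = 0].  Kober's
    inequality gives the quadratic decay in the standard deviation. *)
Lemma ratio_rate_le b u : 0 < b < 1 -> 0 < u ->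
  (1 - b) * ln u - ln (u * (1 - b) + b) <=
  - (Num.min b (1 - b) * (Num.sqrt u - 1) ^+ 2 / (u * (1 - b) + b)).
Proof.
move=> b01 u0; have [b0 b1] := andP b01.
set L := u * (1 - b) + b; have L0 : 0 < L.
  by rewrite addr_gt0// mulr_gt0// subr_gt0.
have := Kober_expR (ln u / 2) b01.
rewrite -sqrt_expR_ln// sqr_sqrtr; last exact: ltW.
rewrite [(1 - b) * u]mulrC -/L.
set z := _ * (_ - 1) ^+ 2.
rewrite (_ : 2 * (1 - b) * (ln u / 2) = (1 - b) * ln u); last by field.
move=> H; rewrite lerBlDr -ler_expR expRD (lnK L0).
apply: (le_trans H); rewrite -ler_pdivrMr//.
have -> : (L - z) / L = 1 + - (z / L) by field; rewrite gt_eqF.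
exact: expR_ge1Dx.
Qed.

Lemma ratio_rate_near b : 0 < b < 1 -> exists2 c : R, 0 < c &
  forall u, 0 < u -> u * (1 - b) + b <= 2 ->
  ((1 - b) * ln u - ln (u * (1 - b) + b)) / 2 <= - (c * (u - 1) ^+ 2).
Proof.
move=> b01; have [b0 b1] := andP b01; set m := Num.min b (1 - b).
have m0 : 0 < m by rewrite lt_min b0 subr_gt0.
(* u1 is the solution of u (1 - b) + b = 2. *)
pose u1 := (2 - b) / (1 - b); have ob : 0 < 1 - b by rewrite subr_gt0.
have u10 : 0 < u1 by rewrite divr_gt0// subr_gt0; lra.
pose K := 8 * (u1 + 1); have K0 : 0 < K by rewrite mulr_gt0 ?addr_gt0.
exists (m / K) => [|u u0 uL]; first by rewrite divr_gt0.
have uu1 : u <= u1 by rewrite /u1 ler_pdivlMr//; lra.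
rewrite ler_pdivrMr//; apply: (le_trans (ratio_rate_le b01 u0)); rewrite -/m.
set L := u * (1 - b) + b; have L0 : 0 < L by rewrite addr_gt0// mulr_gt0.
rewrite mulNr lerN2.
set s := Num.sqrt u; have s0 : 0 <= s := sqrtr_ge0 _.
have us : u = s ^+ 2 by rewrite sqr_sqrtr// ltW.
have -> : m / K * (u - 1) ^+ 2 * 2 = m * ((s - 1) ^+ 2 * ((s + 1) ^+ 2 / (K / 2))).
  by rewrite us; field; rewrite gt_eqF.
rewrite -(mulrA m); apply: ler_wpM2l; first exact: ltW.
apply: ler_wpM2l; first exact: sqr_ge0.
apply: (@le_trans _ _ 2^-1); last by rewrite lef_pV2 ?posrE.
rewrite ler_pdivrMr ?divr_gt0// /K.
have : s ^+ 2 <= u1 by rewrite -us.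
by have := sqr_ge0 (s - 1); rewrite !expr2; nra.
Qed.

Lemma ratio_rate_far b : 0 < b < 1 -> exists2 c : R, 0 < c &
  forall u, 0 < u -> 2 <= u * (1 - b) + b ->
  ((1 - b) * ln u - ln (u * (1 - b) + b)) / 2 <= - c.
Proof.
move=> b01; have [b0 b1] := andP b01; set m := Num.min b (1 - b).
have m0 : 0 < m by rewrite lt_min b0 subr_gt0.
exists (m / 32) => [|u u0 uL]; first by rewrite divr_gt0.
rewrite ler_pdivrMr//; apply: (le_trans (ratio_rate_le b01 u0)); rewrite -/m.
have u2 : 2 <= u by nra.
rewrite mulNr lerN2.
set s := Num.sqrt u; have s0 : 0 <= s := sqrtr_ge0 _.
have us : u = s ^+ 2 by rewrite sqr_sqrtr// ltW.
have s43 : 4 / 3 <= s.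
  by rewrite -[leLHS]ger0_norm ?divr_ge0// -sqrtr_sqr ler_wsqrtr//; lra.
set L := u * (1 - b) + b in uL *; have L0 : 0 < L by lra.
have Lu : L <= u by rewrite /L; nra.
have -> : m / 32 * 2 = m * (1 / 16) by field.
rewrite -mulrA; apply: ler_wpM2l; first exact: ltW.
rewrite ler_pdivlMr//; apply: (@le_trans _ _ (1 / 16 * u)).
  by rewrite ler_wpM2l// divr_ge0.
by rewrite us; nra.
Qed.

(** The counterpart of [ratio_rate_le] at the exponent [- b], from
    [u ^ b <= b u + 1 - b]. *)
Lemma ratio_rate_neg b u : 0 < b < 1 -> 1 <= u ->
  ((1 + b) * ln u - ln (u * (1 + b) - b)) / 2 <= (u - 1) ^+ 2 / 2.
Proof.
move=> b01 u1; have [b0 b1] := andP b01.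
have u0 : 0 < u by lra.
set L := _ - b; have L1 : 1 <= L by rewrite /L; nra.
rewrite ler_pM2r ?invr_gt0// lerBlDr -ler_expR expRD lnK ?posrE; last by lra.
rewrite mulrDl mul1r expRD lnK ?posrE//.
have := @weighted_expR_AMGM b (ln u) 0.
rewrite mulr0 addr0 expR0 lnK ?posrE// => H.
apply: (@le_trans _ _ (u * (b * u + (1 - b) * 1))).
  by apply: ler_wpM2l; [exact: ltW|apply: H; rewrite !ltW].
apply: (@le_trans _ _ ((1 + (u - 1) ^+ 2) * L)).
  have -> : u * (b * u + (1 - b) * 1) = L + b * (u - 1) ^+ 2 by rewrite /L; ring.
  rewrite mulrDl mul1r lerD2l mulrC ler_wpM2l ?sqr_ge0//; lra.
by rewrite ler_wpM2r ?expR_ge1Dx//; lra.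
Qed.

(** For [u >= 1] the density in the numerator of the ratio has the heavier tail,
    so that the power [- b] is integrable. *)
Lemma integral_tempered_ratioN_le b u k : 0 < b < 1 -> 1 <= u ->
  (\int[normal_prob 0 1]_e (tempered_ratio (- b) u k e)%:E <=
   (expR ((u - 1) ^+ 2 / 2 + k ^+ 2))%:E)%E.
Proof.
move=> b01 u1; have [b0 b1] := andP b01.
have L1 : 1 <= u * (1 - - b) + - b by nra.
rewrite integral_tempered_ratio; [|lra|lra].
rewrite lee_fin ler_expR; apply: lerD.
  by rewrite !opprK; exact: ratio_rate_neg.
rewrite -mulNr ler_pdivrMr; last lra.
have -> : - (- b * (1 - - b) * k ^+ 2) = k ^+ 2 * (b * (1 + b)) by ring.
by rewrite ler_wpM2l ?sqr_ge0//; nra.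
Qed.

End GaussianRatio.
(** * Renyi divergence in Gaussian regression *)

Lemma measurable_gaussian_fun (R : realType) dT (T : measurableType dT)
    (p q : T -> R) (c w : R) :
  measurable_fun setT p -> measurable_fun setT q ->
  measurable_fun setT (fun t => c * expR (- (p t - q t) ^+ 2 / w)).
Proof.
move=> mp mq; apply: measurable_funM => //; apply: measurableT_comp => //.
apply: measurable_funM => //; apply: measurableT_comp => //.
by apply: measurable_funX; exact: measurable_funB.
Qed.

Section GaussianRenyi.
Context (R : realType) dX (TX : measurableType dX) (mu : probability TX R).
Variables (b v : R) (f g : TX -> R).
Hypotheses (b01 : 0 < b < 1) (v0 : 0 < v) (mf : measurable_fun setT f)
  (mg : measurable_fun setT g).

Definition regression_density (h : TX -> R) (w : R)
    (z : TX * measurableTypeR R) : R :=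
  (Num.sqrt (2 * pi * w))^-1 * expR (- (z.2 - h z.1) ^+ 2 / (2 * w)).

Definition regression_renyi : \bar R :=
  renyi_divergence (mu \x (@lebesgue_measure R))%E b
    (regression_density f v) (regression_density g v).

Lemma regression_densityE (h : TX -> R) (z : TX * measurableTypeR R) :
  regression_density h v z =
  expR (- (z.2 - h z.1) ^+ 2 / (2 * v) - ln (2 * pi * v) / 2).
Proof.
by rewrite /regression_density sqrt_expR_ln ?mulr_gt0 ?pi_gt0// -expRN -expRD addrC.
Qed.

Lemma measurable_regression_density (h : TX -> R) :
  measurable_fun setT h -> measurable_fun setT (regression_density h v).
Proof.
move=> mh; apply: measurable_gaussian_fun; first exact: measurable_snd.
by apply: measurableT_comp; [exact: mh|exact: measurable_fst].
Qed.

(** [exp (- (1 - b) D_b)] for the two regression densities with variance [v]. *)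
Definition gaussian_affinity : \bar R :=
  (\int[mu]_x (expR (- (b * (1 - b) * (f x - g x) ^+ 2 / (2 * v))))%:E)%E.

Let measurable_affinity_fun :
  measurable_fun setT (fun x => expR (- (b * (1 - b) * (f x - g x) ^+ 2 / (2 * v)))).
Proof.
rewrite (_ : (fun x => _) = fun x =>
    1 * expR (- (f x - g x) ^+ 2 / (2 * v / (b * (1 - b))))).
  exact: measurable_gaussian_fun.
by apply/funext => x; rewrite mul1r invf_div; congr expR; ring.
Qed.

Lemma gaussian_affinity_ge0 : (0 <= gaussian_affinity)%E.
Proof. by apply: integral_ge0 => x _; rewrite lee_fin expR_ge0. Qed.

Lemma gaussian_affinity_le1 : (gaussian_affinity <= 1)%E.
Proof.
have [b0 b1] := andP b01.
rewrite -(@probability_setT _ _ _ mu) -[leRHS]mul1e -integral_cst//.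
apply: ge0_le_integral => //.
- exact/measurable_EFinP.
- move=> x _; rewrite lee_fin expR_le1 oppr_le0; apply: divr_ge0.
    apply: mulr_ge0; last exact: sqr_ge0.
    by apply: mulr_ge0; rewrite ?subr_ge0 ltW.
  by apply: mulr_ge0 => //; exact: ltW.
Qed.

(** The product of the powers [b] and [1 - b] of two Gaussian densities with
    the same variance is a multiple of a Gaussian density centred between. *)
Lemma regression_renyi_affinity :
  regression_renyi = (- (1 - b)^-1%:E * lne gaussian_affinity)%E.
Proof.
have [b0 b1] := andP b01.
rewrite /regression_renyi /renyi_divergence; congr (_ * lne _)%E.
rewrite fubini_tonelli1; first last.
- by move=> z; rewrite lee_fin mulr_ge0// powR_ge0.
- apply/measurable_EFinP/measurable_funM; 
  apply: (measurableT_comp (measurable_powR _)).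
    exact: measurable_regression_density.
  exact: measurable_regression_density.
apply: eq_integral => x _; rewrite /fubini_F.
have s0 : Num.sqrt v != 0 by rewrite gt_eqF// sqrtr_gt0.
transitivity (\int[lebesgue_measure]_y
  ((expR (- (b * (1 - b) * (f x - g x) ^+ 2 / (2 * v))))%:E *
   (normal_pdf (b * f x + (1 - b) * g x) (Num.sqrt v) y)%:E))%E.
  apply: eq_integral => y _; rewrite -EFinM; congr (_%:E).
  rewrite !regression_densityE -!expRM normal_pdfE// /normal_peak /normal_fun.
  rewrite sqr_sqrtr; last exact: ltW.
  rewrite -mulrnAr (_ : v * _ = 2 * pi * v); last first.
    by rewrite -mulr_natr; ring.
  rewrite sqrt_expR_ln ?mulr_gt0 ?pi_gt0// -expRN -!expRD; congr expR => /=.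
  by field; rewrite gt_eqF.
rewrite ge0_integralZl//.
- by rewrite integral_normal_pdf mule1.
- by apply/measurable_EFinP; exact: measurable_normal_pdf.
- by move=> y _; rewrite lee_fin normal_pdf_ge0.
Qed.

Lemma regression_renyi_le (x : R) :
  (regression_renyi <= x%:E)%E =
  ((expR (- ((1 - b) * x)))%:E <= gaussian_affinity)%E.
Proof.
have [b0 b1] := andP b01.
rewrite regression_renyi_affinity.
have := gaussian_affinity_ge0; have := gaussian_affinity_le1.
case: gaussian_affinity => // r _; rewrite lee_fin le_eqVlt => /predU1P[<-|r0].
  rewrite le0_lneNy// mulNe gt0_muleNy ?lte_fin ?invr_gt0 ?subr_gt0//=.
  by rewrite leye_eq/= lee_fin leNgt expR_gt0.
rewrite lne_EFin// -EFinN -EFinM !lee_fin -[in RHS](lnK r0) ler_expR.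
by rewrite mulNr lerNl mulrC ler_pdivlMr ?subr_gt0// mulNr (mulrC x).
Qed.

End GaussianRenyi.
(** * Joint measurability in parameters and data *)

Section JointMeasurability.
Context (R : realType) dT (T : measurableType dT).
Implicit Types p q r : T -> R.

(** Inversion is not continuous at 0, but [x^-1 = x * (x ^ 2) `^ (-1)]. *)
Lemma measurable_fun_inv p :
  measurable_fun setT p -> measurable_fun setT (fun t => (p t)^-1).
Proof.
move=> mp; rewrite (_ : (fun t => _) = fun t => p t * (p t ^+ 2) `^ (-1)).
  apply: measurable_funM => //; apply: (measurableT_comp (measurable_powR _)).
  exact: measurable_funX.
apply/funext => t; rewrite powR_inv1 ?sqr_ge0// expr2.
have [->|pt0] := eqVneq (p t) 0; first by rewrite invr0 mul0r.
by rewrite invfM mulrA mulfV// mul1r.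
Qed.

Lemma measurable_fun_tempered_ratio a p q r :
  measurable_fun setT p -> measurable_fun setT q -> measurable_fun setT r ->
  measurable_fun setT (fun t => tempered_ratio a (p t) (q t) (r t)).
Proof.
move=> mp mq mr; apply: measurableT_comp => //; apply: measurable_funM => //.
apply: measurable_funB; last first.
  by apply: measurable_funM => //; exact: measurableT_comp.
apply: measurable_funB.
  by apply: measurable_funM => //; exact: measurable_funX.
apply: measurable_funM; first by apply: measurable_funX; exact: measurable_funB.
by apply: measurable_fun_inv; exact: measurable_funM.
Qed.

Lemma measurable_fun_normal_density p q r :
  measurable_fun setT p -> measurable_fun setT q -> measurable_fun setT r ->
  measurable_fun setT (fun t => (Num.sqrt (2 * pi * r t))^-1 *
    expR (- (p t - q t) ^+ 2 / (2 * r t))).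
Proof.
move=> mp mq mr; apply: measurable_funM.
  apply: measurable_fun_inv; apply: measurableT_comp; last exact: measurable_funM.
  by apply: continuous_measurable_fun; exact: sqrt_continuous.
apply: measurableT_comp => //; apply: measurable_funM.
  apply: measurableT_comp => //.
  by apply: measurable_funX; exact: measurable_funB.
by apply: measurable_fun_inv; exact: measurable_funM.
Qed.

End JointMeasurability.

(** * Integrals over the variance *)

Section LaplaceIntegrals.
Context (R : realType).
Implicit Types k m b : R.

Lemma integral_gaussian k m : 0 < k ->
  (\int[@lebesgue_measure R]_v (expR (- (k * (v - m) ^+ 2)))%:E =
   (Num.sqrt (pi / k))%:E)%E.
Proof.
move=> k0; pose s := Num.sqrt (2 * k)^-1.
have s2 : s ^+ 2 = (2 * k)^-1 by rewrite sqr_sqrtr// invr_ge0 mulr_ge0// ltW.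
have s0 : s != 0 by rewrite gt_eqF// sqrtr_gt0 invr_gt0 mulr_gt0.
have peakE : normal_peak s = (Num.sqrt (pi / k))^-1.
  rewrite /normal_peak s2; congr (Num.sqrt _)^-1; rewrite -mulr_natr.
  by field; rewrite gt_eqF.
have p0 : 0 < Num.sqrt (pi / k) by rewrite sqrtr_gt0 divr_gt0 ?pi_gt0.
transitivity (\int[@lebesgue_measure R]_v
    ((Num.sqrt (pi / k))%:E * (normal_pdf m s v)%:E))%E.
  apply: eq_integral => v _; rewrite -EFinM normal_pdfE// peakE mulVKf ?gt_eqF//.
  rewrite /normal_fun s2; congr (expR _)%:E; rewrite -mulr_natr.
  by field; rewrite gt_eqF.
rewrite ge0_integralZl//.
- by rewrite integral_normal_pdf mule1.
- by apply/measurable_EFinP; exact: measurable_normal_pdf.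
- by move=> y _; rewrite lee_fin normal_pdf_ge0.
Qed.

Lemma integral_exponential_le b : 0 < b ->
  (\int[@lebesgue_measure R]_(v in [set v | (0 < v)%R]) (expR (- (b * v)))%:E <=
   b^-1%:E)%E.
Proof.
move=> b0; have mpos : measurable [set v : measurableTypeR R | (0 < v)%R].
  by rewrite -set_itvoy; exact: measurable_itv.
have mpdf : measurable_fun setT
    (fun v : measurableTypeR R => (exponential_pdf b v)%:E).
  by apply/measurable_EFinP; exact: measurable_exponential_pdf.
have pdf0 v : (0 <= (exponential_pdf b v)%:E)%E.
  by rewrite lee_fin exponential_pdf_ge0// ltW.
rewrite (eq_integral
  (fun v : measurableTypeR R => b^-1%:E * (exponential_pdf b v)%:E)%E); last first.
  move=> v; rewrite inE /= => v0.
  by rewrite exponential_pdfE ?(ltW v0)// -EFinM mulKf ?gt_eqF// mulNr.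
rewrite ge0_integralZl//; last 2 first.
- exact: measurable_funTS.
- by rewrite lee_fin invr_ge0 ltW.
rewrite -[leRHS]mule1; apply: lee_wpmul2l; first by rewrite lee_fin invr_ge0 ltW.
rewrite -(integral_exponential_pdf b0).
exact: ge0_subset_integral.
Qed.

End LaplaceIntegrals.

Section FlatPrior.
Context (R : realType) dT (Theta : measurableType dT) (Pif : probability Theta R).

(** Named so as to carry a sigma-finite structure. *)
Definition flat_prior : set (Theta * measurableTypeR R) -> \bar R :=
  (Pif \x (@lebesgue_measure R))%E.

HB.instance Definition _ := Measure.on flat_prior.

Let flat_prior_sigma_finite : sigma_finite setT flat_prior.
Proof.
have /sigma_finiteP[G [TG _ Goo]] := sigma_finiteT (@lebesgue_measure R).
exists (fun n => setT `*` G n).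
  rewrite -setXTT TG; apply/seteqP; split => -[t v].
    by move=> [_ [n _ Gv]]; exists n.
  by move=> [n _ [_ Gv]]; split => //; exists n.
move=> n; have [mG Gfin] := Goo n; split; first exact: measurableX.
rewrite /flat_prior (_ : (_ \x _)%E _ = (Pif setT * lebesgue_measure (G n))%E).
  by rewrite probability_setT mul1e.
exact: product_measure1E.
Qed.

HB.instance Definition _ := Measure_isSigmaFinite.Build _ _ _ flat_prior
  flat_prior_sigma_finite.

Lemma integral_flat_prior_le (H : measurableTypeR R -> \bar R) A B :
  measurable_fun setT H -> (forall v, 0 <= H v)%E ->
  measurable A -> measurable B ->
  (\int[flat_prior]_(p in A `*` B) H p.2 <= \int[lebesgue_measure]_(v in B) H v)%E.
Proof.
move=> mH H0 mA mB.
have mH2 : measurable_fun setT (fun p : Theta * measurableTypeR R => H p.2).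
  exact: (measurableT_comp mH measurable_snd).
have mHB : measurable_fun setT (H \_ B).
  by apply/(measurable_restrictT H mB); exact: measurable_funTS.
apply: (@le_trans _ _ (\int[flat_prior]_(p in setT `*` B) H p.2)%E).
  apply: ge0_subset_integral => //; [exact: measurableX..| |].
    exact: measurable_funTS.
  by move=> [t v] [].
rewrite integral_mkcond (eq_integral (fun p => (H \_ B) p.2)); last first.
  move=> [t v] _; rewrite !patchE/=.
  suff -> : (t, v) \in setT `*` B = (v \in B) by [].
  by apply/idP/idP; rewrite !inE => // -[].
rewrite /flat_prior fubini_tonelli1; first last.
- by move=> [t v] /=; rewrite patchE; case: ifP.
- exact: (measurableT_comp mHB measurable_snd).
rewrite (eq_integral (fun=> \int[lebesgue_measure]_v (H \_ B) v)%E)//.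
rewrite integral_cst// [leRHS]integral_mkcond.
rewrite [X in (_ * X)%E](_ : _ = 1%E) ?mule1//.
exact: probability_setT.
Qed.

End FlatPrior.

(** * Tempered likelihood and evidence *)

Section FractionalEvidence.
Context (R : realType) dX (TX : measurableType dX)
  (dO : measure_display) (Omega : measurableType dO)
  (X : {mfun Omega >-> TX} ^nat) (eta : {mfun Omega >-> measurableTypeR R} ^nat)
  (dT : measure_display) (Theta : measurableType dT) (F : Theta -> TX -> R).
Hypothesis hF : measurable_fun setT (fun p : Theta * TX => F p.1 p.2).
Variables (b s0 : R) (f0 : TX -> R).
Hypotheses (b01 : 0 < b < 1) (hs0 : 0 < s0) (mf0 : measurable_fun setT f0).
Variables (n : nat) (Pif : probability Theta R)
  (pis : probability (measurableTypeR R) R).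
Hypothesis hpis : is_Gamma ((1 - b) / 2 * n%:R + 1) b pis.

Local Notation pos := [set v : measurableTypeR R | 0 < v].
Local Notation obs i w := (X i w, f0 (X i w) + Num.sqrt s0 * eta i w).

Lemma measurable_pos : measurable pos.
Proof. by rewrite -set_itvoy; exact: measurable_itv. Qed.

(** The error of the regression function, in units of the noise. *)
Definition std_shift (th : Theta) (x : TX) : R := (F th x - f0 x) / Num.sqrt s0.

(** The variance [v] is read as [u = b v / s0], which is 1 for the truth once
    the posterior is tempered. *)
Definition ratio_product a (w : Omega) (p : Theta * measurableTypeR R) : R :=
  \prod_(i < n) tempered_ratio a (b * p.2 / s0) (std_shift p.1 (X i w)) (eta i w).

Lemma ratio_product_gt0 a w p : 0 < ratio_product a w p.
Proof. by apply: prodr_gt0 => i _; exact: tempered_ratio_gt0. Qed.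

Lemma ratio_productN a w p : ratio_product (- a) w p = (ratio_product a w p)^-1.
Proof.
by rewrite /ratio_product -prodfV; apply: eq_bigr => i _; rewrite tempered_ratioN.
Qed.

(** The unnormalised posterior mass of [A], relative to the tempered likelihood
    of the truth; of the Gamma density only the exponential factor remains. *)
Definition evidence (A : set Theta) (w : Omega) : \bar R :=
  (\int[flat_prior Pif]_(p in A `*` pos)
     (expR (- (b * p.2)) * ratio_product b w p)%:E)%E.

Let mFX i : measurable_fun setT
  (fun z : Omega * (Theta * measurableTypeR R) => F z.2.1 (X i z.1)).
Proof.
rewrite (_ : (fun z => _) = (fun p : Theta * TX => F p.1 p.2) \o
  (fun z : Omega * (Theta * measurableTypeR R) => (z.2.1, X i z.1)))//.
apply: measurableT_comp; first exact: hF.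
apply/measurable_fun_pairP; split.
  exact: (measurableT_comp measurable_fst measurable_snd).
exact: (measurableT_comp (measurable_funP (X i)) measurable_fst).
Qed.

Let mf0X i : measurable_fun setT
  (fun z : Omega * (Theta * measurableTypeR R) => f0 (X i z.1)).
Proof.
apply: measurableT_comp => //.
exact: (measurableT_comp (measurable_funP (X i)) measurable_fst).
Qed.

Let meta i : measurable_fun setT
  (fun z : Omega * (Theta * measurableTypeR R) => (eta i z.1 : R)).
Proof. exact: (measurableT_comp (measurable_funP (eta i)) measurable_fst). Qed.

Let mvar : measurable_fun setT
  (fun z : Omega * (Theta * measurableTypeR R) => (z.2.2 : R)).
Proof. exact: (measurableT_comp measurable_snd measurable_snd). Qed.

Lemma measurable_ratio_product a : measurable_fun setT
  (fun z : Omega * (Theta * measurableTypeR R) => ratio_product a z.1 z.2).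
Proof.
apply: measurable_prod => i _; apply: measurable_fun_tempered_ratio => //.
- by apply: measurable_funM => //; exact: measurable_funM.
- by apply: measurable_funM => //; exact: measurable_funB.
Qed.

Lemma measurable_joint_integrand : measurable_fun setT
  (fun z : Omega * (Theta * measurableTypeR R) =>
     (expR (- (b * z.2.2)) * ratio_product b z.1 z.2)%:E).
Proof.
apply/measurable_EFinP/measurable_funM; last exact: measurable_ratio_product.
apply: measurableT_comp => //; apply: measurableT_comp => //.
exact: measurable_funM.
Qed.

Lemma joint_integrand_ge0 w (p : Theta * measurableTypeR R) :
  0 <= expR (- (b * p.2)) * ratio_product b w p.
Proof. by rewrite mulr_ge0 ?expR_ge0// ltW// ratio_product_gt0. Qed.

Let mslice (D : set (Theta * measurableTypeR R)) w
    (h : Omega * (Theta * measurableTypeR R) -> \bar R) :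
  measurable_fun setT h -> measurable_fun D (fun p => h (w, p)).
Proof.
move=> mh; apply: measurable_funTS; apply: (measurableT_comp mh).
exact: measurable_pair1.
Qed.

Lemma measurable_evidence A : measurable A -> measurable_fun setT (evidence A).
Proof.
move=> mA; apply: (measurable_fun_integral_on (flat_prior Pif)
  measurable_joint_integrand _ (measurableX mA measurable_pos)).
by move=> z; rewrite lee_fin joint_integrand_ge0.
Qed.

Lemma evidence_ge0 A w : (0 <= evidence A w)%E.
Proof. by apply: integral_ge0 => p _; rewrite lee_fin joint_integrand_ge0. Qed.

Lemma evidence_setU A B w : measurable A -> measurable B -> A `&` B = set0 ->
  evidence (A `|` B) w = (evidence A w + evidence B w)%E.
Proof.
move=> mA mB AB; have mAB := measurableU _ _ mA mB.
have sXU : (A `|` B) `*` pos = (A `*` pos) `|` (B `*` pos).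
  apply/seteqP; split => -[t v] /=; first by move=> [[At|Bt] v0]; [left|right].
  by move=> [[At v0]|[Bt v0]]; split => //; [left|right].
rewrite /evidence sXU ge0_integral_setU//.
- by apply: measurableX => //; exact: measurable_pos.
- by apply: measurableX => //; exact: measurable_pos.
- exact: mslice measurable_joint_integrand.
- by move=> p _; rewrite lee_fin joint_integrand_ge0.
- apply/disj_setPS => -[t v] /= [[At _] [Bt _]].
  by have : (A `&` B) t by []; rewrite AB.
Qed.

Lemma evidence_le A B w : measurable A -> measurable B -> A `<=` B ->
  (evidence A w <= evidence B w)%E.
Proof.
move=> mA mB AB; apply: ge0_subset_integral.
- by apply: measurableX => //; exact: measurable_pos.
- by apply: measurableX => //; exact: measurable_pos.
- exact: mslice measurable_joint_integrand.
- by move=> p _; rewrite lee_fin joint_integrand_ge0.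
- by move=> [t v] [/= At v0]; split => //; exact: AB.
Qed.

Lemma integral_prior_flat : exists2 c : R, 0 < c &
  forall g : Theta * measurableTypeR R -> \bar R,
  measurable_fun setT g -> (forall p, 0 <= g p)%E ->
  (\int[Pif \x pis]_p g p = \int[flat_prior Pif]_(p in setT `*` pos)
     (g p * (c * (p.2 `^ ((1 - b) / 2 * n%:R) * expR (- (b * p.2))))%:E))%E.
Proof.
case: (integral_Gamma hpis) => c c0 cE; exists c => // g mg g0.
rewrite addrK in cE.
pose W (v : measurableTypeR R) :=
  c * (v `^ ((1 - b) / 2 * n%:R) * expR (- (b * v))).
have mW : measurable_fun setT W.
  apply: measurable_funM => //; apply: measurable_funM => //.
  by apply: measurableT_comp => //; apply: measurableT_comp => //;
    exact: measurable_funM.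
have W0 v : 0 <= W v.
  by apply: mulr_ge0; [exact: ltW|rewrite mulr_ge0 ?powR_ge0 ?expR_ge0].
rewrite fubini_tonelli1// [RHS]integral_mkcond /flat_prior.
pose gW (p : Theta * measurableTypeR R) := (g p * (W p.2)%:E)%E.
have mgW : measurable_fun setT (gW \_ (setT `*` pos)).
  apply/(measurable_restrictT gW (measurableX measurableT measurable_pos)).
  apply: measurable_funTS; apply: emeasurable_funM => //.
  apply/measurable_EFinP; exact: (measurableT_comp mW measurable_snd).
rewrite fubini_tonelli1//; last first.
  move=> p; rewrite patchE; case: ifP => // _.
  by apply: mule_ge0; [exact: g0|rewrite lee_fin; exact: W0].
apply: eq_integral => th _; rewrite /fubini_F cE//; last first.
  by apply: (measurableT_comp mg); exact: measurable_pair1.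
rewrite [LHS]integral_mkcond; apply: eq_integral => v _; rewrite !patchE.
suff -> : (th, v) \in setT `*` pos = (v \in pos) by [].
by apply/idP/idP; rewrite !inE => // -[].
Qed.

(** The power [(1 - b) / 2] of [v] is the share of one observation in the Gamma
    density; it leaves the power [- b / 2] of a normalising factor to the
    [b]-th power. *)
Lemma density_ratioE th v x e : 0 < v ->
  regression_density (F th) v (x, f0 x + Num.sqrt s0 * e) * v `^ ((1 - b) / 2) =
  expR (b / 2 * (ln b - ln s0) - b / 2 * e ^+ 2 - ln (2 * pi) / 2) *
  tempered_ratio b (b * v / s0) (std_shift th x) e.
Proof.
move=> v0; have [b0 b1] := andP b01.
rewrite regression_densityE// /powR gt_eqF// /tempered_ratio -!expRD.
have -> : ln (2 * pi * v) = ln (2 * pi) + ln v.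
  by rewrite [LHS]lnM ?posrE ?mulr_gt0 ?pi_gt0.
have -> : ln (b * v / s0) = ln b + ln v - ln s0.
  by rewrite ln_div ?posrE ?mulr_gt0// lnM.
congr expR.
rewrite /std_shift /=; set r := Num.sqrt s0.
have r0 : r != 0 by rewrite gt_eqF// sqrtr_gt0.
have -> : b * v / s0 = b * v / r ^+ 2 by rewrite sqr_sqrtr// ltW.
by field; rewrite r0 !gt_eqF.
Qed.

(** The factor [K] depends on the data but not on the event, so that it cancels
    in Bayes' formula. *)
Lemma integral_likelihood_evidence w : exists2 K : R, 0 < K &
  (forall A, measurable A ->
   \int[Pif \x pis]_(p in A `*` pos)
     (\prod_(i < n) regression_density (F p.1) p.2 (obs i w))%:E =
   K%:E * evidence A w)%E /\
  (\int[Pif \x pis]_p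
     (\prod_(i < n) regression_density (F p.1) p.2 (obs i w))%:E =
   K%:E * evidence setT w)%E.
Proof.
have [c c0 cE] := integral_prior_flat.
pose kappa e :=
  expR (b / 2 * (ln b - ln s0) - b / 2 * e ^+ 2 - ln (2 * pi) / 2).
pose K := c * \prod_(i < n) kappa (eta i w).
have K0 : 0 < K by rewrite mulr_gt0// prodr_gt0// => i _; exact: expR_gt0.
pose h (p : Theta * measurableTypeR R) :=
  (\prod_(i < n) regression_density (F p.1) p.2 (obs i w))%:E.
have h0 p : (0 <= h p)%E.
  by rewrite lee_fin prodr_ge0// => i _; rewrite mulr_ge0 ?expR_ge0.
have mh : measurable_fun setT h.
  apply/measurable_EFinP; apply: measurable_prod => i _.
  apply: measurable_fun_normal_density => //.
  exact: (measurableT_comp (mFX i) (measurable_pair1 w)).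
have hE p : 0 < p.2 ->
    (h p * (c * (p.2 `^ ((1 - b) / 2 * n%:R) * expR (- (b * p.2))))%:E)%E =
    (K%:E * (expR (- (b * p.2)) * ratio_product b w p)%:E)%E.
  move=> v0; rewrite /h -!EFinM; congr (_%:E).
  rewrite powRrM powR_mulrn ?powR_ge0//.
  rewrite -[in X in _ ^+ X](card_ord n) -prodr_const.
  rewrite mulrCA [X in c * X]mulrA -big_split/= (eq_bigr _ (fun (i : 'I_n) _ =>
    density_ratioE p.1 (X i w) (eta i w) v0)) big_split/=.
  rewrite /K /ratio_product /kappa -!mulrA; congr (_ * (_ * _)).
  exact: mulrC.
have hA A : measurable A ->
    (\int[Pif \x pis]_p (h \_ (A `*` pos)) p = K%:E * evidence A w)%E.
  move=> mA; have mAp := measurableX mA measurable_pos.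
  rewrite cE; first last.
  - by move=> p; rewrite patchE; case: ifP.
  - by apply/(measurable_restrictT h mAp); exact: measurable_funTS.
  rewrite /evidence -ge0_integralZl//; last 3 first.
  - exact: mslice measurable_joint_integrand.
  - by move=> p _; rewrite lee_fin joint_integrand_ge0.
  - by rewrite lee_fin ltW.
  rewrite [LHS]integral_mkcond [RHS]integral_mkcond; apply: eq_integral => p _.
  rewrite !patchE; have [pT|pT] := boolP (p \in _); last first.
    by rewrite ifF//; apply/negbTE; apply: contra pT; rewrite !inE => -[].
  case: ifPn => pA; last by rewrite mul0e.
  by apply: hE; move: pT; rewrite inE => -[].
exists K => //; split; first by move=> A mA; rewrite -hA// [LHS]integral_mkcond.
rewrite -hA//; rewrite !cE//; first last.
- by move=> p; rewrite patchE; case: ifP.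
- apply/(measurable_restrictT h (measurableX measurableT measurable_pos)).
  exact: measurable_funTS.
by apply: eq_integral => p pT; rewrite patchE pT.
Qed.

End FractionalEvidence.
(** * The mean evidence away from the truth *)

Section ExpectedEvidence.
Context (R : realType) dX (TX : measurableType dX) (mu : probability TX R)
  (dO : measure_display) (Omega : measurableType dO) (P : probability Omega R)
  (X : {mfun Omega >-> TX} ^nat) (eta : {mfun Omega >-> measurableTypeR R} ^nat).
Hypotheses
  (lawX : forall i A, measurable A -> distribution P (X i) A = mu A)
  (lawe : forall i A, measurable A ->
     distribution P (eta i) A = normal_prob 0 1 A)
  (indXe : forall i, indep_pair P (X i) (eta i))
  (indZ : mutual_indep P (fun i w => (X i w, eta i w))).
Context (dT : measure_display) (Theta : measurableType dT) (F : Theta -> TX -> R).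
Hypothesis hF : measurable_fun setT (fun p : Theta * TX => F p.1 p.2).
Variables (b s0 : R) (f0 : TX -> R).
Hypotheses (b01 : 0 < b < 1) (hs0 : 0 < s0) (mf0 : measurable_fun setT f0).
Variables (n : nat) (Pif : probability Theta R).

Local Notation pos := [set v : measurableTypeR R | 0 < v].
Local Notation ratio := (ratio_product X eta F b s0 f0 n).
Local Notation ev := (evidence X eta F b s0 f0 n Pif).
Local Notation affinity th := (gaussian_affinity mu b (2 * s0) (F th) f0).
Local Notation uu v := (b * v / s0).

Lemma measurable_section_fun th : measurable_fun setT (F th).
Proof. exact: (measurableT_comp hF (measurable_pair1 th)). Qed.

Lemma measurable_std_shift th : measurable_fun setT (std_shift F s0 f0 th).
Proof.
apply: measurable_funM => //; apply: measurable_funB => //.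
exact: measurable_section_fun.
Qed.

Lemma expected_ratio_product_le a p (B : R) :
  (\int[mu]_x \int[normal_prob 0 1]_e
     (tempered_ratio a (uu p.2) (std_shift F s0 f0 p.1 x) e)%:E <= B%:E)%E ->
  (\int[P]_w (ratio a w p)%:E <= (B ^+ n)%:E)%E.
Proof.
move=> hB; apply: (expectation_prod_design_noise_le lawX lawe indXe indZ (phi :=
  fun z => tempered_ratio a (uu p.2) (std_shift F s0 f0 p.1 z.1) z.2)) => //.
- apply: measurable_fun_tempered_ratio => //.
  exact: (measurableT_comp (measurable_std_shift p.1) measurable_fst).
- by move=> z; rewrite ltW// tempered_ratio_gt0.
Qed.

Lemma std_shift_sqr th x :
  std_shift F s0 f0 th x ^+ 2 = (F th x - f0 x) ^+ 2 / s0.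
Proof.
by rewrite /std_shift expr_div_n sqr_sqrtr// ltW.
Qed.

Lemma affinity_fin th : exists2 r : R, affinity th = r%:E & 0 <= r <= 1.
Proof.
have mF := measurable_section_fun th.
have s20 : 0 < 2 * s0 by rewrite mulr_gt0.
have := gaussian_affinity_le1 mu b01 s20 mF mf0.
have := gaussian_affinity_ge0 mu b (2 * s0) (F th) f0.
by case: (affinity th) => // r; rewrite !lee_fin => r0 r1; exists r; rewrite ?r0.
Qed.

Section ForwardRatio.
Variables (c1 c2 : R).
Hypotheses (c10 : 0 < c1) (c20 : 0 < c2).
Hypothesis near1 : forall u, 0 < u -> u * (1 - b) + b <= 2 ->
  ((1 - b) * ln u - ln (u * (1 - b) + b)) / 2 <= - (c1 * (u - 1) ^+ 2).
Hypothesis far1 : forall u, 0 < u -> 2 <= u * (1 - b) + b ->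
  ((1 - b) * ln u - ln (u * (1 - b) + b)) / 2 <= - c2.

(** The part of the overlap that depends on the regression function is an
    affinity at variance [s0 (u (1 - b) + b)], hence at most the one at
    variance [2 s0] in the first case. *)
Lemma integral_ratio_le th v (r : R) : 0 < v -> affinity th = r%:E -> 0 <= r <= 1 ->
  (\int[mu]_x \int[normal_prob 0 1]_e
     (tempered_ratio b (uu v) (std_shift F s0 f0 th x) e)%:E <=
   (if (uu v * (1 - b) + b <= 2)%R then expR (- (c1 * (uu v - 1) ^+ 2)) * r
    else expR (- c2))%:E)%E.
Proof.
have [b0 b1] := andP b01; move=> v0 thr /andP[r0 r1].
have u0 : 0 < uu v by rewrite divr_gt0// mulr_gt0.
set u := uu v in u0 *; set L := u * (1 - b) + b.
have L0 : 0 < L by rewrite addr_gt0// mulr_gt0// subr_gt0.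
have Bk0 x : 0 <= b * (1 - b) * std_shift F s0 f0 th x ^+ 2.
  apply: mulr_ge0; last exact: sqr_ge0.
  by apply: mulr_ge0; rewrite ?subr_ge0 ltW.
pose G x := expR (((1 - b) * ln u - ln L) / 2 -
   b * (1 - b) * std_shift F s0 f0 th x ^+ 2 / (2 * L)).
have mG : measurable_fun setT G.
  apply: measurableT_comp => //; apply: measurable_funB => //.
  apply: measurable_funM => //; apply: measurable_funM => //.
  by apply: measurable_funX; exact: measurable_std_shift.
under eq_integral do rewrite integral_tempered_ratio//.
rewrite -/L; case: ifPn => uL; last first.
  apply: (@le_trans _ _ (\int[mu]_x (expR (- c2))%:E)%E).
    apply: ge0_le_integral => //.
    - apply/measurable_EFinP; exact: mG.
    - move=> x _; rewrite lee_fin ler_expR lerBlDr ler_wpDr//.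
        by rewrite divr_ge0// mulr_ge0// ltW.
      by apply: far1 => //; rewrite ltW// ltNge.
  rewrite integral_cst// [X in (_ * X)%E](_ : _ = 1%E) ?mule1//.
  exact: probability_setT.
rewrite EFinM -thr /gaussian_affinity -ge0_integralZl//; first last.
- apply/measurable_EFinP; apply: measurableT_comp => //; apply: measurableT_comp => //.
  apply: measurable_funM => //; apply: measurable_funM => //; apply: measurable_funX.
  by apply: measurable_funB => //; exact: measurable_section_fun.
apply: ge0_le_integral => //.
- apply/measurable_EFinP; exact: mG.
- apply/measurable_EFinP; apply: measurable_funM => //.
  apply: measurableT_comp => //; apply: measurableT_comp => //.
  apply: measurable_funM => //; apply: measurable_funM => //; apply: measurable_funX.
  by apply: measurable_funB => //; exact: measurable_section_fun.
move=> x _; rewrite -EFinM lee_fin -expRD ler_expR; apply: lerD; first exact: near1.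
rewrite lerN2.
have -> : b * (1 - b) * (F th x - f0 x) ^+ 2 / (2 * (2 * s0)) =
    b * (1 - b) * std_shift F s0 f0 th x ^+ 2 * (2 * 2)^-1.
  by rewrite std_shift_sqr; field; rewrite gt_eqF.
apply: ler_wpM2l => //.
by rewrite lef_pV2 ?posrE ?mulr_gt0// ler_wpM2l.
Qed.

(** The square root, of order [n ^ (- 1 / 2)], is the Gaussian integral over
    the variances of moderate size; the other term bounds the contribution of
    the larger ones. *)
Lemma expected_evidence_le A (r : R) : (0 < n)%N -> measurable A -> 0 <= r <= 1 ->
  (forall th, A th -> (affinity th <= r%:E)%E) ->
  (\int[P]_w ev A w <=
   (r ^+ n * Num.sqrt (pi / (n%:R * c1 * (b / s0) ^+ 2)) +
    expR (- (c2 * n%:R)) / b)%:E)%E.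
Proof.
have [b0 b1] := andP b01; move=> n0 mA /andP[r0 r1] hA.
have mApos := measurableX mA (@measurable_pos R).
pose k := n%:R * c1 * (b / s0) ^+ 2.
have k0 : 0 < k.
  by apply: mulr_gt0; [rewrite mulr_gt0 ?ltr0n|rewrite exprn_gt0// divr_gt0].
pose H1 (v : measurableTypeR R) := r ^+ n * expR (- (k * (v - s0 / b) ^+ 2)).
pose H2 (v : measurableTypeR R) := expR (- (c2 * n%:R)) * expR (- (b * v)).
have mH1 : measurable_fun setT (fun v => (H1 v)%:E).
  apply/measurable_EFinP; apply: measurable_funM => //; apply: measurableT_comp => //.
  apply: measurableT_comp => //; apply: measurable_funM => //; apply: measurable_funX.
  exact: measurable_funB.
have mH2 : measurable_fun setT (fun v => (H2 v)%:E).
  apply/measurable_EFinP; apply: measurable_funM => //; apply: measurableT_comp => //.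
  by apply: measurableT_comp => //; exact: measurable_funM.
have H10 v : (0 <= (H1 v)%:E)%E by rewrite lee_fin mulr_ge0 ?exprn_ge0 ?expR_ge0.
have H20 v : (0 <= (H2 v)%:E)%E by rewrite lee_fin mulr_ge0 ?expR_ge0.
have jge0 (z : Omega * (Theta * measurableTypeR R)) :
    (0 <= (expR (- (b * z.2.2)) * ratio b z.1 z.2)%:E)%E.
  by rewrite lee_fin joint_integrand_ge0.
rewrite /evidence (fubini_tonelli_on P (flat_prior Pif)
  (measurable_joint_integrand X eta hF b s0 mf0 n) jge0 mApos).
apply: (@le_trans _ _ (\int[flat_prior Pif]_(p in A `*` pos)
    (((H1 p.2)%:E + (H2 p.2)%:E)))%E).
  apply: ge0_le_integral => //.
  - move=> p _; apply: integral_ge0 => w _.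
    by rewrite lee_fin joint_integrand_ge0.
  - apply: measurable_funTS; exact: (measurable_fun_integral_fst P
      (measurable_joint_integrand X eta hF b s0 mf0 n) jge0).
  - apply: measurable_funTS; apply: emeasurable_funD.
      exact: (measurableT_comp mH1 measurable_snd).
    exact: (measurableT_comp mH2 measurable_snd).
  move=> [th v] [/= Ath v0].
  have [rt thE /andP[rt0 rt1]] := affinity_fin th.
  have rtr : rt <= r by rewrite -lee_fin -thE hA.
  have u0 : 0 < uu v by rewrite divr_gt0// mulr_gt0.
  rewrite (eq_integral (fun w => (expR (- (b * v)))%:E *
    (ratio b w (th, v))%:E)%E); last by move=> w _; rewrite EFinM.
  rewrite ge0_integralZl//; first last.
  - by move=> w _; rewrite lee_fin ltW// ratio_product_gt0.
  - apply/measurable_EFinP.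
    exact: (measurableT_comp (measurable_ratio_product X eta hF b s0 mf0 n b)
             (measurable_pair2 (th, v))).
  have rt01 : 0 <= rt <= 1 by rewrite rt0.
  have := expected_ratio_product_le (p := (th, v)) (integral_ratio_le v0 thE rt01).
  move=> hB; apply: (le_trans (lee_wpmul2l _ hB)); first by rewrite lee_fin expR_ge0.
  rewrite -EFinM -EFinD lee_fin.
  have e1 : expR (- (b * v)) <= 1.
    by rewrite expR_le1 oppr_le0; apply: mulr_ge0; exact: ltW.
  case: ifP => _.
    apply: (@le_trans _ _ (H1 v)); last by rewrite lerDl -lee_fin.
    rewrite -[leRHS]mul1r; apply: ler_pM => //.
      by rewrite exprn_ge0// mulr_ge0.
    rewrite exprMn mulrC -expRM_natl; apply: ler_pM.
    + exact: exprn_ge0.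
    + exact: expR_ge0.
    + by apply: lerXn2r; rewrite ?nnegrE.
    + rewrite ler_expR le_eqVlt; apply/orP; left; apply/eqP.
      by rewrite /k; field; rewrite !gt_eqF.
  apply: (@le_trans _ _ (H2 v)); last by rewrite lerDr -lee_fin.
  by rewrite /H2 mulrC -expRM_natr mulNr.
have mH12 := emeasurable_funD mH1 mH2.
have H120 v : (0 <= (H1 v)%:E + (H2 v)%:E)%E by rewrite adde_ge0.
apply: (@le_trans _ _ (\int[lebesgue_measure]_(v in pos) ((H1 v)%:E + (H2 v)%:E))%E).
  exact: (integral_flat_prior_le Pif mH12 H120 mA (@measurable_pos R)).
rewrite ge0_integralD//; first last.
- exact: measurable_funTS.
- exact: measurable_funTS.
- exact: measurable_pos.
rewrite EFinD; apply: leeD.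
  apply: (@le_trans _ _ (\int[lebesgue_measure]_v (H1 v)%:E)%E).
    by apply: ge0_subset_integral => //; exact: measurable_pos.
  rewrite (eq_integral (fun v : measurableTypeR R => (r ^+ n)%:E *
    (expR (- (k * (v - s0 / b) ^+ 2)))%:E)%E)//.
  rewrite ge0_integralZl//; first last.
  - by rewrite lee_fin exprn_ge0.
  - apply/measurable_EFinP; apply: measurableT_comp => //.
    apply: measurableT_comp => //; apply: measurable_funM => //; apply: measurable_funX.
    exact: measurable_funB.
  by rewrite integral_gaussian.
rewrite (eq_integral (fun v : measurableTypeR R => (expR (- (c2 * n%:R)))%:E *
    (expR (- (b * v)))%:E)%E)//.
rewrite ge0_integralZl//; first last.
- apply/measurable_EFinP; apply: measurableT_comp => //.
  by apply: measurableT_comp => //; exact: measurable_funM.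
- exact: measurable_pos.
rewrite EFinM; apply: lee_wpmul2l; first by rewrite lee_fin expR_ge0.
exact: integral_exponential_le.
Qed.

End ForwardRatio.

(** * A lower bound for the evidence *)

Lemma integral_ratioN_le th v (e : R) : 1 <= uu v ->
  (forall x, (F th x - f0 x) ^+ 2 <= e ^+ 2) ->
  (\int[mu]_x \int[normal_prob 0 1]_z
     (tempered_ratio (- b) (uu v) (std_shift F s0 f0 th x) z)%:E <=
   (expR ((uu v - 1) ^+ 2 / 2 + e ^+ 2 / s0))%:E)%E.
Proof.
move=> u1 hle.
apply: (@le_trans _ _ (\int[mu]_x
    (expR ((uu v - 1) ^+ 2 / 2 + e ^+ 2 / s0))%:E)%E); last first.
  rewrite integral_cst// [X in (_ * X)%E](_ : _ = 1%E) ?mule1//.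
  exact: probability_setT.
apply: ge0_le_integral => //.
- by move=> x _; apply: integral_ge0 => z _; rewrite lee_fin expR_ge0.
- apply: (@measurable_fun_integral_on _ _ TX (measurableTypeR R) R (normal_prob 0 1)
    (fun z => (tempered_ratio (- b) (uu v) (std_shift F s0 f0 th z.1) z.2)%:E) setT) => //.
    apply/measurable_EFinP; apply: measurable_fun_tempered_ratio => //.
    exact: (measurableT_comp (measurable_std_shift th) measurable_fst).
  by move=> z; rewrite lee_fin expR_ge0.
move=> x _; apply: (le_trans (integral_tempered_ratioN_le _ b01 u1)).
rewrite lee_fin ler_expR lerD2l std_shift_sqr ler_wpM2r//.
by rewrite invr_ge0 ltW.
Qed.

(** The evidence is rarely much smaller than the prior mass near the truth.
    Writing [r] for the tempered likelihood ratio, [r + t ^ 2 / r >= 2 t] turns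
    Markov's inequality for the integral of [1 / r] over the box
    [B x [s0 / b, s0 / b (1 + n ^ (- 1 / 2))]] into a lower bound for the
    integral of [r]. *)
Lemma evidence_lower B (e q : R) : (0 < n)%N -> measurable B -> 0 < q ->
  (q%:E <= Pif B)%E ->
  (forall th, B th -> forall x, (F th x - f0 x) ^+ 2 <= e ^+ 2) ->
  (P [set w | (ev setT w <
     (expR (- (2 * s0)) * expR (- (n%:R * e ^+ 2 / s0 + 1 / 2 + n%:R * e ^+ 2)) *
      (q * (s0 / b / Num.sqrt n%:R)))%:E)%E] <= (expR (- (n%:R * e ^+ 2)))%:E)%E.
Proof.
have [b0 b1] := andP b01; move=> n0 mB q0 qB hB.
have sn0 : 0 < Num.sqrt (n%:R : R) by rewrite sqrtr_gt0 ltr0n.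
have snn : Num.sqrt (n%:R : R) ^+ 2 = n%:R by rewrite sqr_sqrtr.
have sn1 : 1 <= Num.sqrt (n%:R : R) by rewrite -[leLHS]sqrtr1 ler_wsqrtr// ler1n.
set sn := Num.sqrt _ in sn0 snn sn1 *.
pose l := s0 / b / sn; have l0 : 0 < l by rewrite !divr_gt0.
pose U : set (measurableTypeR R) := [set` `[s0 / b, s0 / b + l]%R].
have mU : measurable U by exact: measurable_itv.
have mS := measurableX mB mU.
have Ul : (lebesgue_measure U = l%:E)%E.
  by rewrite /U lebesgue_measure_itv/= lte_fin ltrDl l0 -EFinD addrC addKr.
have PB1 : (Pif B <= 1)%E := probability_le1 Pif mB.
have PBfin : Pif B \is a fin_num := fin_num_measure Pif B mB.
pose m := fine (Pif B) * l.
have qPB : q <= fine (Pif B) by rewrite -lee_fin fineK.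
have m0 : 0 < m by rewrite mulr_gt0// (lt_le_trans q0).
have QS : (flat_prior Pif (B `*` U) = m%:E)%E.
  rewrite /flat_prior (_ : (_ \x _)%E _ = (Pif B * lebesgue_measure U)%E).
    by rewrite Ul -(fineK PBfin).
  exact: product_measure1E.
set xi := n%:R * e ^+ 2 / s0 + 1 / 2; set ne := n%:R * e ^+ 2.
pose t := expR (- (xi + ne)); have t0 : 0 < t := expR_gt0 _.
have Upos v : U v -> [/\ 0 < v, 1 <= uu v, uu v <= 1 + sn^-1 & b * v <= 2 * s0].
  rewrite /U/= in_itv/= => /andP[v1 v2].
  have v0 : 0 < v by apply: lt_le_trans v1; rewrite divr_gt0.
  have bv : b * v <= s0 * (1 + sn^-1).
    apply: (@le_trans _ _ (b * (s0 / b + l))); first by rewrite ler_pM2l.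
    rewrite le_eqVlt; apply/orP; left; apply/eqP.
    by rewrite /l; field; rewrite !gt_eqF.
  split => //.
  - by rewrite ler_pdivlMr// mul1r mulrC -ler_pdivrMr.
  - by rewrite ler_pdivrMr// [leRHS]mulrC.
  - apply: (le_trans bv); rewrite mulrC; apply: ler_wpM2r; first exact: ltW.
    by rewrite lerD2l invf_le1.
pose gen a (z : Omega * (Theta * measurableTypeR R)) := (ratio a z.1 z.2)%:E.
have mgen a : measurable_fun setT (gen a).
  by apply/measurable_EFinP; exact: measurable_ratio_product.
have gen0 a z : (0 <= gen a z)%E by rewrite lee_fin ltW// ratio_product_gt0.
have mgenS a w : measurable_fun (B `*` U) (fun p => (ratio a w p)%:E).
  apply: measurable_funTS.
  exact: (measurableT_comp (mgen a) (measurable_pair1 w)).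
pose V (w : Omega) := (\int[flat_prior Pif]_(p in B `*` U) gen (- b)%R (w, p))%E.
have mV : measurable_fun setT V.
  exact: (measurable_fun_integral_on (flat_prior Pif) (mgen (- b)) (gen0 (- b)) mS).
have V0 w : (0 <= V w)%E by apply: integral_ge0.
have EV : (\int[P]_w V w <= (m * expR xi)%:E)%E.
  rewrite (fubini_tonelli_on P (flat_prior Pif) (mgen (- b)) (gen0 (- b)) mS).
  apply: (@le_trans _ _ (\int[flat_prior Pif]_(p in B `*` U) (expR xi)%:E)%E).
    apply: ge0_le_integral => //.
    - by move=> p _; apply: integral_ge0.
    - apply: measurable_funTS.
      exact: (measurable_fun_integral_fst P (mgen (- b)) (gen0 (- b))).
    move=> [th v] [/= Bth Uv]; have [v0 u1 u2 _] := Upos _ Uv.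
    have := expected_ratio_product_le (p := (th, v))
      (@integral_ratioN_le th v e u1 (hB _ Bth)).
    move/le_trans; apply; rewrite lee_fin -expRM_natl ler_expR /xi mulrDr addrC.
    rewrite mulrA lerD2l mulrA ler_pdivrMr// divfK// -ler_pdivlMl ?ltr0n//.
    rewrite mulr1 -snn -exprVn; apply: lerXn2r; rewrite ?nnegrE ?subr_ge0//.
      by rewrite invr_ge0 ltW.
    by rewrite lerBlDl.
  by rewrite integral_cst// [X in (_ * X)%E](_ : _ = m%:E)// -EFinM mulrC.
(* The level in Markov's inequality: exp ne times the bound on the mean of V. *)
pose a := m * expR (xi + ne); have a0 : 0 < a by rewrite mulr_gt0// expR_gt0.
have mPV : measurable [set w | (a%:E <= V w)%E].
  by rewrite -[X in measurable X]setTI; exact: emeasurable_fun_c_infty.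
have markovV : (P [set w | (a%:E <= V w)%E] <= (expR (- ne))%:E)%E.
  have := le_integral_abse P measurableT mV a0.
  rewrite setTI (_ : [set x | _] = [set w | (a%:E <= V w)%E]); last first.
    by apply/seteqP; split => w /=; rewrite gee0_abs.
  under eq_integral do rewrite gee0_abs//.
  move=> /le_trans/(_ EV); rewrite -lee_pdivlMl// => /le_trans; apply.
  rewrite -EFinM lee_fin /a expRD invfM expRN.
  by rewrite le_eqVlt; apply/orP; left; apply/eqP; field; rewrite !gt_eqF ?expR_gt0.
apply: le_trans markovV; apply: le_measure.
- rewrite inE -[X in measurable X]setTI; apply: emeasurable_fun_infty_o => //.
  exact: measurable_evidence.
- by rewrite inE.
move=> w /= evlt; rewrite leNgt; apply/negP => Va; move: evlt; apply/negP.
rewrite -leNgt.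
pose I := (\int[flat_prior Pif]_(p in B `*` U) (ratio b w p)%:E)%E.
have tmI : ((t * m)%:E <= I)%E.
  have H : ((2 * t * m)%:E <= I + (t ^+ 2)%:E * V w)%E.
    rewrite /V -ge0_integralZl//; first last.
    - by rewrite lee_fin sqr_ge0.
    - exact: mgenS.
    rewrite -ge0_integralD//; first last.
    - by apply: emeasurable_funM => //; exact: mgenS.
    - by move=> p _; rewrite mule_ge0// lee_fin sqr_ge0.
    - by move=> p _; exact: (gen0 b (w, p)).
    rewrite (_ : (2 * t * m)%:E =
        (\int[flat_prior Pif]_(p in B `*` U) (2 * t)%:E)%E); last first.
      by rewrite integral_cst// [X in (_ * X)%E](_ : _ = m%:E)// -EFinM.
    apply: ge0_le_integral => //.
    - by move=> p _; rewrite lee_fin mulr_ge0// ltW.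
    - apply: emeasurable_funD => //.
      by apply: emeasurable_funM => //; exact: mgenS.
    move=> p _; rewrite -EFinM -EFinD lee_fin /= ratio_productN.
    have r0 : 0 < ratio b w p by exact: ratio_product_gt0.
    rewrite -subr_ge0 (_ : _ - _ = (ratio b w p - t) ^+ 2 / ratio b w p).
      by rewrite divr_ge0 ?sqr_ge0// ltW.
    by field; rewrite gt_eqF.
  have H2 : ((t ^+ 2)%:E * V w <= (t * m)%:E)%E.
    apply: (@le_trans _ _ ((t ^+ 2)%:E * a%:E)%E).
      by apply: lee_wpmul2l; [rewrite lee_fin sqr_ge0|exact: ltW].
    rewrite -EFinM lee_fin /a /t expRN le_eqVlt; apply/orP; left; apply/eqP.
    by field; rewrite gt_eqF ?expR_gt0.
  have := le_trans H (leeD2l I H2).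
  rewrite -leeBlDr// -EFinB (_ : 2 * t * m - t * m = t * m)//; ring.
apply: (@le_trans _ _ ((expR (- (2 * s0)))%:E * I)%E).
  apply: (@le_trans _ _ ((expR (- (2 * s0)))%:E * (t * m)%:E)%E).
    rewrite -EFinM lee_fin -mulrA; apply: ler_wpM2l; first exact: expR_ge0.
    apply: ler_wpM2l; first exact: ltW.
    by rewrite /m; apply: ler_wpM2r => //; exact: ltW.
  by apply: lee_wpmul2l => //; rewrite lee_fin expR_ge0.
rewrite /I -ge0_integralZl//; first last.
- by move=> p _; exact: (gen0 b (w, p)).
apply: (@le_trans _ _ (\int[flat_prior Pif]_(p in B `*` U)
    (expR (- (b * p.2)) * ratio b w p)%:E)%E).
  apply: ge0_le_integral => //.
  - move=> p _; apply: mule_ge0; first by rewrite lee_fin expR_ge0.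
    exact: (gen0 b (w, p)).
  - by apply: emeasurable_funM => //; exact: mgenS.
  - apply: measurable_funTS.
    exact: (measurableT_comp (measurable_joint_integrand X eta hF b s0 mf0 n)
             (measurable_pair1 w)).
  move=> [th v] [/= _ Uv]; have [_ _ _ bv] := Upos _ Uv.
  rewrite -EFinM lee_fin; apply: ler_wpM2r; first by rewrite ltW// ratio_product_gt0.
  by rewrite ler_expR lerN2.
rewrite /evidence; apply: ge0_subset_integral => //.
- by apply: measurableX => //; exact: measurable_pos.
- apply: measurable_funTS.
  exact: (measurableT_comp (measurable_joint_integrand X eta hF b s0 mf0 n)
           (measurable_pair1 w)).
- by move=> p _; rewrite lee_fin joint_integrand_ge0.
- by move=> [th v] [/= _ Uv]; have [v0 _ _ _] := Upos _ Uv.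
Qed.

End ExpectedEvidence.
(** * Posterior masses *)

Section PosteriorMass.
Context (R : realType) dX (TX : measurableType dX)
  (dO : measure_display) (Omega : measurableType dO)
  (X : {mfun Omega >-> TX} ^nat) (eta : {mfun Omega >-> measurableTypeR R} ^nat)
  (dT : measure_display) (Theta : measurableType dT) (F : Theta -> TX -> R).
Hypothesis hF : measurable_fun setT (fun p : Theta * TX => F p.1 p.2).
Variables (b s0 : R) (f0 : TX -> R).
Hypotheses (b01 : 0 < b < 1) (hs0 : 0 < s0) (mf0 : measurable_fun setT f0).
Variables (n : nat) (Pif : probability Theta R).

Local Notation pos := [set v : measurableTypeR R | 0 < v].
Local Notation ev := (evidence X eta F b s0 f0 n Pif).

Definition posterior_mass A w : R := fine (ev A w) / fine (ev setT w).

Let fineZ (K : R) (x : \bar R) : 0 < K -> fine (K%:E * x) = K * fine x.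
Proof.
move=> K0; case: x => [x| |]//; first by rewrite gt0_muley ?lte_fin//= mulr0.
by rewrite gt0_muleNy ?lte_fin//= mulr0.
Qed.

Lemma posterior_evidence (pis : probability (measurableTypeR R) R) A w :
  is_Gamma ((1 - b) / 2 * n%:R + 1) b pis -> measurable A ->
  posterior (Pif \x pis)%E (fun p => regression_density (F p.1) p.2)
    [tuple (X i w, f0 (X i w) + Num.sqrt s0 * eta i w) | i < n] (A `*` pos) =
  posterior_mass A w.
Proof.
move=> hpis mA.
have [K K0 [KA KT]] :=
  integral_likelihood_evidence X eta hF b01 hs0 mf0 Pif hpis w.
rewrite /posterior /posterior_mass.
under eq_integral do under eq_bigr do rewrite tnth_mktuple.
rewrite (KA _ mA).
under eq_integral do under eq_bigr do rewrite tnth_mktuple.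
by rewrite KT !fineZ// invfM mulrACA divff ?mul1r ?gt_eqF.
Qed.

Lemma measurable_posterior_mass A : measurable A ->
  measurable_fun setT (posterior_mass A).
Proof.
move=> mA; apply: measurable_funM.
  by apply: measurableT_comp => //; exact: measurable_evidence.
apply: measurable_fun_inv; apply: measurableT_comp => //.
exact: measurable_evidence.
Qed.

Lemma posterior_mass_ge0 A w : 0 <= posterior_mass A w.
Proof. by rewrite divr_ge0 ?fine_ge0 ?evidence_ge0. Qed.

(** A total evidence equal to 0 or infinite is sent to 0 by [fine], and then all
    quotients are 0. *)
Lemma posterior_mass_cases w :
  (forall A, posterior_mass A w = 0) \/
  exists2 t : R, 0 < t & ev setT w = t%:E.
Proof.
have := evidence_ge0 X eta F b s0 f0 n Pif setT w.
rewrite /posterior_mass; case: (ev setT w) => [t| |]//= t0.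
- move: t0; rewrite lee_fin le_eqVlt => /predU1P[<-|t0]; last by right; exists t.
  by left => A; rewrite invr0 mulr0.
- by left => A; rewrite invr0 mulr0.
Qed.

Let ev_fin A w (t : R) : measurable A -> ev setT w = t%:E ->
  ev A w \is a fin_num.
Proof.
move=> mA evT; rewrite ge0_fin_numE ?evidence_ge0//.
rewrite (@le_lt_trans _ _ (ev setT w)) ?evT ?ltry//.
by rewrite -evT; exact: evidence_le.
Qed.

Lemma posterior_mass_le A B w : measurable A -> measurable B -> A `<=` B ->
  posterior_mass A w <= posterior_mass B w.
Proof.
move=> mA mB AB.
have [w0|[t t0 evT]] := posterior_mass_cases w; first by rewrite !w0.
rewrite /posterior_mass ler_wpM2r//; first by rewrite evT invr_ge0 ltW.
by apply: fine_le; rewrite ?(ev_fin _ evT)//; exact: evidence_le.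
Qed.

Lemma posterior_mass_le1 A w : measurable A -> posterior_mass A w <= 1.
Proof.
move=> mA; apply: (le_trans (posterior_mass_le w mA measurableT (@subsetT _ A))).
have [->//|[t t0 evT]] := posterior_mass_cases w.
by rewrite /posterior_mass evT/= divff// gt_eqF.
Qed.

Lemma posterior_massI A B w : measurable A -> measurable B ->
  posterior_mass A w + posterior_mass B w <= posterior_mass (A `&` B) w + 1.
Proof.
move=> mA mB; have [w0|[t t0 evT]] := posterior_mass_cases w.
  by rewrite !w0 addr0 add0r ler01.
have mBC := measurableC mB; have mAB := measurableI _ _ mA mB.
have h1 : (ev A w <= ev (A `&` B) w + ev (~` B) w)%E.
  rewrite -evidence_setU//; last by apply/seteqP; split => th // -[[]].
  apply: evidence_le => //; first exact: measurableU.
  by move=> th Ath; have [Bth|nBth] := pselect (B th); [left|right].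
have h2 : (ev setT w = ev B w + ev (~` B) w)%E.
  by rewrite -evidence_setU ?setUv// setICr.
rewrite /posterior_mass evT/= -[X in _ <= _ + X](@divff _ t) ?gt_eqF// -!mulrDl.
apply: ler_wpM2r; first by rewrite invr_ge0 ltW.
move: h1 h2; rewrite evT -(fineK (ev_fin mA evT)) -(fineK (ev_fin mB evT)).
rewrite -(fineK (ev_fin mAB evT)) -(fineK (ev_fin mBC evT)) -!EFinD lee_fin/=.
by move=> h1 [->]; lra.
Qed.

Section Expectation.
Variable P : probability Omega R.

(** Off the event that the total evidence falls below [t], the posterior mass of
    the complement of [A] is at most its evidence divided by [t]; only this
    quotient has to be integrated. *)
Lemma expected_posterior_mass_ge A (t k del : R) : measurable A -> 0 < t ->
  (\int[P]_w ev setT w < +oo)%E ->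
  (\int[P]_w ev (~` A) w <= k%:E)%E ->
  (P [set w | (ev setT w < t%:E)%E] <= del%:E)%E ->
  ((1 - (del + k / t))%:E <= \int[P]_w (posterior_mass A w)%:E)%E.
Proof.
move=> mA t0 evfin evk evdel.
have mev B : measurable B -> measurable_fun setT (ev B).
  by move=> mB; exact: measurable_evidence.
pose S := [set w | (ev setT w < t%:E)%E].
have mS : measurable S.
  rewrite -[X in measurable X]setTI.
  by apply: emeasurable_fun_infty_o => //; exact: mev.
have mAC := measurableC mA.
have mp : measurable_fun setT (fun w => (posterior_mass A w)%:E).
  by apply/measurable_EFinP; exact: measurable_posterior_mass.
have mS1 : measurable_fun setT (fun w => (\1_S w)%:E : \bar R).
  by apply/measurable_EFinP; exact: measurable_indic.
have mN : measurable_fun setT (fun w => (t^-1)%:E * ev (~` A) w)%E.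
  by apply: measurable_funeM; exact: mev.
have t10 : (0 <= (t^-1)%:E)%E by rewrite lee_fin invr_ge0 ltW.
have N0 w : (0 <= (t^-1)%:E * ev (~` A) w)%E.
  by apply: mule_ge0 => //; exact: evidence_ge0.
have p0 w : (0 <= (posterior_mass A w)%:E)%E by rewrite lee_fin posterior_mass_ge0.
have S0 w : (0 <= (\1_S w)%:E :> \bar R)%E by rewrite lee_fin.
have aefin : {ae P, forall w, setT w -> ev setT w \is a fin_num}.
  apply: integrable_ae => //; apply/integrableP; split; first exact: mev.
  by under eq_integral do rewrite gee0_abs ?evidence_ge0//.
have one : (1 <= \int[P]_w ((posterior_mass A w)%:E + (\1_S w)%:E +
    (t^-1)%:E * ev (~` A) w))%E.
  rewrite -[leLHS](@probability_setT _ _ _ P) -[leLHS]mul1e -integral_cst//.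
  apply: ae_ge0_le_integral => //.
  - by move=> w _; apply: adde_ge0 => //; exact: adde_ge0.
  - by apply: emeasurable_funD => //; exact: emeasurable_funD.
  apply: filterS aefin => w /(_ Logic.I) wfin _.
  have [wS|wS] := boolP (w \in S).
    rewrite indicE wS; apply: (@le_trans _ _ ((posterior_mass A w)%:E + 1)%E).
      by rewrite leeDr.
    by rewrite leeDl.
  have tw : t <= fine (ev setT w).
    move: wS; rewrite notin_setE /S /= => /negP; rewrite -leNgt.
    by rewrite -[X in (_ <= X)%E](fineK wfin) lee_fin.
  have evT : ev setT w = (fine (ev setT w))%:E by rewrite fineK.
  have T0 : 0 < fine (ev setT w) := lt_le_trans t0 tw.
  rewrite indicE (negbTE wS) adde0.
  have h2 : (ev setT w = ev A w + ev (~` A) w)%E.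
    by rewrite -evidence_setU ?setUv// setICr.
  move: h2; rewrite evT -(fineK (ev_fin mA evT)) -(fineK (ev_fin mAC evT)).
  rewrite -EFinM -!EFinD lee_fin => -[h2].
  have c0 : 0 <= fine (ev (~` A) w) by rewrite fine_ge0 ?evidence_ge0.
  rewrite /posterior_mass -[leLHS](@divff _ (fine (ev setT w))) ?gt_eqF//.
  rewrite [X in X / _ <= _]h2 mulrDl lerD2l mulrC; apply: ler_wpM2r => //.
  by rewrite lef_pV2 ?posrE.
move: one; rewrite ge0_integralD//; last first.
- by apply: emeasurable_funD.
- by move=> w _; exact: adde_ge0.
rewrite ge0_integralD//.
rewrite integral_indic// setIT ge0_integralZl//; last 2 first.
- exact: mev.
- by move=> w _; exact: evidence_ge0.
move=> one.
have : (1 <= \int[P]_w (posterior_mass A w)%:E + (del + k / t)%:E)%E.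
  apply: (le_trans one); rewrite -addeA; apply: leeD2l.
  rewrite EFinD; apply: leeD => //.
  by rewrite mulrC EFinM; apply: lee_wpmul2l.
by rewrite -leeBlDr// -EFinB.
Qed.

Lemma expected_posterior_mass_le1 A : measurable A ->
  (\int[P]_w (posterior_mass A w)%:E <= 1)%E.
Proof.
move=> mA; rewrite -[leRHS](@probability_setT _ _ _ P) -[leRHS]mul1e -integral_cst//.
apply: ge0_le_integral => //.
- by move=> w _; rewrite lee_fin posterior_mass_ge0.
- by apply/measurable_EFinP; exact: measurable_posterior_mass.
- by move=> w _; rewrite lee_fin posterior_mass_le1.
Qed.

Lemma expected_posterior_mass_ge0 A : (0 <= \int[P]_w (posterior_mass A w)%:E)%E.
Proof. by apply: integral_ge0 => w _; rewrite lee_fin posterior_mass_ge0. Qed.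

(** Off an event of small probability [B] costs a posterior mass of at most
    [del]. *)
Lemma expected_posterior_mass_sub A B C (del : R) :
  measurable A -> measurable B -> measurable C -> A `&` B `<=` C -> 0 <= del ->
  (\int[P]_w (posterior_mass A w)%:E <=
   \int[P]_w (posterior_mass C w)%:E + del%:E +
   P [set w | (del <= `|posterior_mass B w - 1|)%R])%E.
Proof.
move=> mA mB mC ABC del0; have mAB := measurableI _ _ mA mB.
pose S := [set w | del <= `|posterior_mass B w - 1|].
have mS : measurable S.
  rewrite -[X in measurable X]setTI.
  have mg : measurable_fun setT (fun w => `|posterior_mass B w - 1|).
    apply: measurableT_comp => //; apply: measurable_funB => //.
    exact: measurable_posterior_mass.
  rewrite (_ : S = (fun w => `|posterior_mass B w - 1|) @^-1` [set` `[del, +oo[]).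
    exact: mg.
  by apply/seteqP; split => w; rewrite /S /= in_itv/= andbT.
have mp D : measurable D -> measurable_fun setT (fun w => (posterior_mass D w)%:E).
  by move=> mD; apply/measurable_EFinP; exact: measurable_posterior_mass.
have mS1 : measurable_fun setT (fun w => (\1_S w)%:E : \bar R).
  by apply/measurable_EFinP; exact: measurable_indic.
have p0 D w : (0 <= (posterior_mass D w)%:E)%E by rewrite lee_fin posterior_mass_ge0.
apply: (@le_trans _ _ (\int[P]_w ((posterior_mass C w)%:E + del%:E + (\1_S w)%:E))%E).
  apply: ge0_le_integral => //.
  - exact: mp.
  - by apply: emeasurable_funD => //; apply: emeasurable_funD => //; exact: mp.
  move=> w _; rewrite -!EFinD lee_fin.
  have hI := posterior_massI w mA mB; have hC := posterior_mass_le w mAB mC ABC.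
  have hA := posterior_mass_le1 w mA; have hC0 := posterior_mass_ge0 C w.
  have [wS|wS] := boolP (w \in S); rewrite indicE ?wS ?(negbTE wS)/=; first by lra.
  move: wS; rewrite notin_setE /S /= => /negP; rewrite -ltNge => hlt.
  by have := ler_norm (- (posterior_mass B w - 1)); rewrite normrN; lra.
rewrite ge0_integralD//; last 2 first.
- by move=> w _; apply: adde_ge0 => //; rewrite lee_fin.
- by apply: emeasurable_funD => //; exact: mp.
rewrite ge0_integralD//; last exact: mp.
rewrite integral_indic// setIT integral_cst//.
rewrite [X in (_ + _ * X + _)%E](_ : _ = 1%E) ?mule1//.
exact: probability_setT.
Qed.

End Expectation.
End PosteriorMass.
(** * Contraction rates *)

Section Limits.
Context (R : realType).

Lemma cvg_to_1 (u : nat -> \bar R) : (forall n, 0 <= u n <= 1)%E ->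
  (forall h : R, 0 < h -> \forall n \near \oo, ((1 - h)%:E <= u n)%E) ->
  u n @[n --> \oo] --> 1%E.
Proof.
move=> u01 uh; have ufin n : u n \is a fin_num.
  have /andP[u0 u1] := u01 n.
  by rewrite ge0_fin_numE//; exact: le_lt_trans u1 (ltry _).
apply/fine_cvgP; split; first exact: nearW.
apply/cvgrPdist_le => h h0; near=> n.
have /andP[_ u1] := u01 n.
have hn : ((1 - h)%:E <= u n)%E by near: n; exact: uh.
rewrite /= ger0_norm.
  by rewrite lerBlDl -lerBlDr -lee_fin fineK.
by rewrite subr_ge0 -lee_fin fineK.
Unshelve. all: by end_near. Qed.

Lemma cvg0_near_le (u : nat -> \bar R) : u n @[n --> \oo] --> 0%E ->
  forall h : R, 0 < h -> \forall n \near \oo, (u n <= h%:E)%E.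
Proof.
move=> /fine_cvgP[uf uc] h h0; near=> n.
have un : `|(fine \o u) n| <= h by near: n; exact: cvgr0_norm_le.
have fn : u n \is a fin_num by near: n.
by rewrite -(fineK fn) lee_fin; exact: le_trans (ler_norm _) un.
Unshelve. all: by end_near. Qed.

(** The balance behind the rate. The evidence is bounded below by
    [n ^ (- 1 / 2) exp (- G n e ^ 2)] up to a constant; the complement of the
    affinity ball contributes [n ^ (- 1 / 2) exp (- (1 - b) M n e ^ 2)], and
    large variances contribute [exp (- c2 n)], which absorbs [n ^ (1 / 2)]
    because [e] is small. *)
Lemma evidence_balance (b s0 c1 c2 D M e : R) (n : nat) :
  0 < b < 1 -> 0 < s0 -> 0 < c1 -> 0 < c2 -> (0 < n)%N ->
  let G := s0^-1 + 1 + D in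
  let K := expR (2 * s0 + 1 / 2) * (b / s0) in
  G + 1 <= (1 - b) * M -> (G + 1) * e ^+ 2 <= c2 / 2 ->
  (expR (- ((1 - b) * (M * e ^+ 2))) ^+ n *
     Num.sqrt (pi / (n%:R * c1 * (b / s0) ^+ 2)) + expR (- (c2 * n%:R)) / b) /
  (expR (- (2 * s0)) * expR (- (n%:R * e ^+ 2 / s0 + 1 / 2 + n%:R * e ^+ 2)) *
     (expR (- (D * n%:R * e ^+ 2)) * (s0 / b / Num.sqrt n%:R))) <=
  (K * Num.sqrt (pi / (c1 * (b / s0) ^+ 2)) + 2 * K / (b * c2)) *
  expR (- (n%:R * e ^+ 2)).
Proof.
move=> /andP[b0 b1] hs0 c10 c20 n0 G K GM Ge.
set x := n%:R * e ^+ 2; have x0 : 0 <= x by rewrite mulr_ge0 ?sqr_ge0.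
have n0R : 0 < n%:R :> R by rewrite ltr0n.
have sn0 : 0 < Num.sqrt (n%:R : R) by rewrite sqrtr_gt0.
have K0 : 0 < K by rewrite mulr_gt0 ?expR_gt0// divr_gt0.
have q0 : 0 < c1 * (b / s0) ^+ 2 by rewrite mulr_gt0// exprn_gt0// divr_gt0.
have sqE : Num.sqrt (pi / (n%:R * c1 * (b / s0) ^+ 2)) =
    Num.sqrt (pi / (c1 * (b / s0) ^+ 2)) / Num.sqrt (n%:R : R).
  rewrite -mulrA invfM mulrCA sqrtrM ?invr_ge0// mulrC.
  by rewrite sqrtrV.
set S := Num.sqrt (pi / (c1 * _)) in sqE *.
have S0 : 0 <= S by exact: sqrtr_ge0.
set sn := Num.sqrt (n%:R : R) in sn0 sqE *.
have tE : (expR (- (2 * s0)) * expR (- (x / s0 + 1 / 2 + x)) *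
    (expR (- (D * n%:R * e ^+ 2)) * (s0 / b / sn)))^-1 = K * expR (G * x) * sn.
  have eE : expR (- (2 * s0)) * expR (- (x / s0 + 1 / 2 + x)) *
      expR (- (D * n%:R * e ^+ 2)) = (expR (2 * s0 + 1 / 2) * expR (G * x))^-1.
    rewrite -!expRD -expRN; congr expR.
    by rewrite /G /x; field; rewrite gt_eqF.
  rewrite mulrA eE /K; field.
  by rewrite !gt_eqF ?expR_gt0.
rewrite tE sqE -expRM_natr {tE sqE}.
rewrite mulrDl [leRHS]mulrDl; apply: lerD.
  have -> : expR (- ((1 - b) * (M * e ^+ 2)) * n%:R) * (S / sn) *
      (K * expR (G * x) * sn) =
      K * S * (expR (- ((1 - b) * (M * e ^+ 2)) * n%:R) * expR (G * x)).
    by field; rewrite gt_eqF.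
  rewrite -expRD; apply: ler_wpM2l; first by rewrite mulr_ge0// ltW.
  rewrite ler_expR; have -> : - ((1 - b) * (M * e ^+ 2)) * n%:R = - ((1 - b) * M * x).
    by rewrite /x; ring.
  by have := ler_wpM2r x0 GM; lra.
have snn : sn <= n%:R.
  have -> : n%:R = sn ^+ 2 by rewrite sqr_sqrtr// ltW.
  rewrite expr2 ler_peMl ?(ltW sn0)//.
  by rewrite -[leLHS]sqrtr1 ler_wsqrtr// ler1n.
have nexp : sn <= 2 / c2 * expR (c2 / 2 * n%:R).
  apply: (le_trans snn); rewrite -ler_pdivrMl ?divr_gt0// invf_div.
  by apply: le_trans (expR_ge1Dx _); rewrite lerDr.
have -> : expR (- (c2 * n%:R)) / b * (K * expR (G * x) * sn) =
    K / b * (sn * (expR (- (c2 * n%:R)) * expR (G * x))) by field; rewrite gt_eqF.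
apply: (@le_trans _ _ (K / b * (2 / c2 * expR (c2 / 2 * n%:R) *
    (expR (- (c2 * n%:R)) * expR (G * x))))).
  apply: ler_wpM2l; first by rewrite divr_ge0 ?ltW.
  by apply: ler_wpM2r => //; rewrite mulr_ge0 ?expR_ge0.
have -> : K / b * (2 / c2 * expR (c2 / 2 * n%:R) *
    (expR (- (c2 * n%:R)) * expR (G * x))) =
    2 * K / (b * c2) * expR (c2 / 2 * n%:R + (- (c2 * n%:R) + G * x)).
  by rewrite !expRD; field; rewrite !gt_eqF.
apply: ler_wpM2l.
  by apply/ltW/divr_gt0; apply: mulr_gt0.
rewrite ler_expR.
by have := ler_wpM2l (ltW n0R) Ge; rewrite /x; nra.
Qed.

End Limits.

Section RegressionContraction.
Context (R : realType) dX (TX : measurableType dX) (mu : probability TX R)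
  (dO : measure_display) (Omega : measurableType dO) (P : probability Omega R)
  (X : {mfun Omega >-> TX} ^nat) (eta : {mfun Omega >-> measurableTypeR R} ^nat).
Hypotheses
  (lawX : forall i A, measurable A -> distribution P (X i) A = mu A)
  (lawe : forall i A, measurable A ->
     distribution P (eta i) A = normal_prob 0 1 A)
  (indXe : forall i, indep_pair P (X i) (eta i))
  (indZ : mutual_indep P (fun i w => (X i w, eta i w))).
Context (dT : measure_display) (Theta : measurableType dT) (F : Theta -> TX -> R).
Hypothesis hF : measurable_fun setT (fun p : Theta * TX => F p.1 p.2).
Variables (b s0 : R) (f0 : TX -> R).
Hypotheses (b01 : 0 < b < 1) (hs0 : 0 < s0) (mf0 : measurable_fun setT f0).

Local Notation affinity th := (gaussian_affinity mu b (2 * s0) (F th) f0).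
Local Notation mass := (posterior_mass X eta F b s0 f0).

Lemma measurable_sublevel (g : Theta -> \bar R) (x : R) :
  measurable_fun setT g -> measurable [set th | (g th <= x%:E)%E].
Proof.
by move=> mg; rewrite -[X in measurable X]setTI; exact: emeasurable_fun_infty_c.
Qed.

Let mdiff2 : measurable_fun setT
  (fun p : Theta * TX => (F p.1 p.2 - f0 p.2) ^+ 2).
Proof.
apply: measurable_funX; apply: measurable_funB; first exact: hF.
exact: (measurableT_comp mf0 measurable_snd).
Qed.

Lemma measurable_affinity : measurable_fun setT (fun th => affinity th).
Proof.
apply: (@measurable_fun_integral_on _ _ Theta TX R mu (fun p =>
  (expR (- (b * (1 - b) * (F p.1 p.2 - f0 p.2) ^+ 2 / (2 * (2 * s0)))))%:E) setT) => //.
  apply/measurable_EFinP; apply: measurableT_comp => //.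
  apply: measurableT_comp => //.
  by apply: measurable_funM => //; apply: measurable_funM.
Qed.

Lemma measurable_L2normsq :
  measurable_fun setT (fun th => L2normsq mu (F th \- f0)%R).
Proof.
apply: (@measurable_fun_integral_on _ _ Theta TX R mu (fun p =>
  ((F p.1 p.2 - f0 p.2) ^+ 2)%:E) setT) => //.
  exact/measurable_EFinP.
by move=> p; rewrite lee_fin sqr_ge0.
Qed.

Definition renyi_ball (x : R) : set Theta :=
  [set th | (regression_renyi mu b (2 * s0) (F th) f0 <= x%:E)%E].

Lemma renyi_ballE x :
  renyi_ball x = [set th | ((expR (- ((1 - b) * x)))%:E <= affinity th)%E].
Proof.
have s20 : 0 < 2 * s0 by rewrite mulr_gt0.
by apply/seteqP; split => th; rewrite /renyi_ball/= regression_renyi_le//;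
   exact: measurable_section_fun.
Qed.

Lemma measurable_renyi_ball x : measurable (renyi_ball x).
Proof.
rewrite renyi_ballE -[X in measurable X]setTI.
by apply: emeasurable_fun_c_infty => //; exact: measurable_affinity.
Qed.

(** For [y] between 0 and [z], [exp (- y) <= 1 - y / (1 + z)], so that one minus
    the affinity dominates a multiple of the squared distance. *)
Lemma L2normsq_le_renyi (K : R) : 0 <= K -> exists2 c : R, 0 < c &
  forall th x, renyi_ball x th -> (forall y, `|F th y - f0 y| <= K) ->
  (L2normsq mu (F th \- f0)%R <= (c * x)%:E)%E.
Proof.
have [b0 b1] := andP b01; move=> K0.
pose a := b * (1 - b) / (2 * (2 * s0)); pose z := a * K ^+ 2.
have a0 : 0 < a by rewrite divr_gt0 ?mulr_gt0 ?subr_gt0.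
have z0 : 0 <= z by rewrite mulr_ge0 ?sqr_ge0// ltW.
pose c3 := a / (1 + z); have z1 : 0 < 1 + z by rewrite ltr_wpDr.
have c30 : 0 < c3 by rewrite divr_gt0.
exists ((1 - b) / c3) => [|th x]; first by rewrite divr_gt0// subr_gt0.
rewrite renyi_ballE /= => aff hK.
have mF := measurable_section_fun hF th.
have mh : measurable_fun setT (fun y => (F th y - f0 y) ^+ 2).
  by apply: measurable_funX; exact: measurable_funB.
have L0 : (0 <= L2normsq mu (F th \- f0)%R)%E.
  by apply: integral_ge0 => y _; rewrite lee_fin sqr_ge0.
have s20 : 0 < 2 * s0 by rewrite mulr_gt0.
have sum1 : (affinity th + c3%:E * L2normsq mu (F th \- f0)%R <= 1)%E.
  rewrite /L2normsq -ge0_integralZl//; first last.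
  - by rewrite lee_fin ltW.
  - by move=> y _; rewrite lee_fin sqr_ge0.
  - exact/measurable_EFinP.
  rewrite /gaussian_affinity -ge0_integralD//; first last.
  - by apply: measurable_funeM; exact/measurable_EFinP.
  - by move=> y _; rewrite -EFinM lee_fin mulr_ge0 ?sqr_ge0// ltW.
  - apply/measurable_EFinP; apply: measurableT_comp => //; apply: measurableT_comp => //.
    by apply: measurable_funM => //; apply: measurable_funM.
  rewrite -[leRHS](@probability_setT _ _ _ mu) -[leRHS]mul1e -integral_cst//.
  apply: ge0_le_integral => //.
  - move=> y _; apply: adde_ge0; first by rewrite lee_fin expR_ge0.
    by rewrite -EFinM lee_fin mulr_ge0 ?sqr_ge0// ltW.
  - apply: emeasurable_funD; last by apply: measurable_funeM; exact/measurable_EFinP.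
    apply/measurable_EFinP; apply: measurableT_comp => //; apply: measurableT_comp => //.
    by apply: measurable_funM => //; apply: measurable_funM.
  move=> y _; rewrite -EFinM -EFinD lee_fin /=; set h2 := (_ - _) ^+ 2.
  have -> : b * (1 - b) * h2 / (2 * (2 * s0)) = a * h2 by rewrite /a; ring.
  have h20 : 0 <= h2 by exact: sqr_ge0.
  have h2K : h2 <= K ^+ 2.
    by rewrite /h2 -real_normK ?num_real//; apply: lerXn2r; rewrite ?nnegrE.
  have ah0 : 0 <= a * h2 by rewrite mulr_ge0// ltW.
  have ahz : a * h2 <= z by rewrite ler_pM2l.
  have p1 : 0 < 1 + a * h2 by rewrite ltr_wpDr.
  have e1 : expR (- (a * h2)) <= (1 + a * h2)^-1.
    by rewrite expRN lef_pV2 ?posrE ?expR_gt0// expR_ge1Dx.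
  have e2 : c3 * h2 <= a * h2 / (1 + a * h2).
    rewrite /c3 mulrAC; apply: ler_wpM2l => //.
    by rewrite lef_pV2 ?posrE// lerD2l.
  apply: (le_trans (lerD e1 e2)); rewrite -{1}[_^-1]mul1r -mulrDl divff//.
  by rewrite gt_eqF.
have sum2 : ((expR (- ((1 - b) * x)))%:E + c3%:E * L2normsq mu (F th \- f0)%R <= 1)%E.
  by apply: le_trans sum1; exact: leeD2r.
have Lfin : L2normsq mu (F th \- f0)%R \is a fin_num.
  rewrite ge0_fin_numE// ltey; apply/eqP => Ly; move: sum2.
  by rewrite Ly gt0_muley ?lte_fin.
move: sum2; rewrite -(fineK Lfin) -EFinM -EFinD !lee_fin => sum2.
rewrite mulrAC ler_pdivlMr// mulrC.
by have := expR_ge1Dx (- ((1 - b) * x)); lra.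
Qed.

(** The two bounds on the evidence, put together at a fixed sample size. *)
Lemma expected_renyi_ball_ge (D : R) : 0 < D ->
  exists M0 C e0 : R, [/\ 0 < M0, 0 < C, 0 < e0 &
  forall (n : nat) (Pif : probability Theta R) (e M : R) (B : set Theta),
  (0 < n)%N -> M0 <= M -> e ^+ 2 <= e0 -> measurable B ->
  (forall th, B th -> forall x, (F th x - f0 x) ^+ 2 <= e ^+ 2) ->
  ((expR (- (D * n%:R * e ^+ 2)))%:E <= Pif B)%E ->
  ((1 - C * expR (- (n%:R * e ^+ 2)))%:E <=
   \int[P]_w (mass n Pif (renyi_ball (M * e ^+ 2)) w)%:E)%E].
Proof.
have [b0 b1] := andP b01; move=> D0.
have [c1 c10 near1] := ratio_rate_near b01.
have [c2 c20 far1] := ratio_rate_far b01.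
pose G := s0^-1 + 1 + D; pose K := expR (2 * s0 + 1 / 2) * (b / s0).
have G0 : 0 < G by rewrite !addr_gt0// invr_gt0.
have G1 : 0 < G + 1 by rewrite addr_gt0.
have K0 : 0 < K by rewrite mulr_gt0 ?expR_gt0// divr_gt0.
pose C := K * Num.sqrt (pi / (c1 * (b / s0) ^+ 2)) + 2 * K / (b * c2).
have C0 : 0 <= C.
  apply: addr_ge0; first exact: mulr_ge0 (ltW K0) (sqrtr_ge0 _).
  by apply/ltW/divr_gt0; apply: mulr_gt0.
exists ((G + 1) / (1 - b)), (1 + C), (c2 / 2 / (G + 1)); split.
- by rewrite divr_gt0// subr_gt0.
- by rewrite ltr_wpDr.
- by rewrite !divr_gt0.
move=> n Pif e M B n0 hM he mB hB hq.
have GM : G + 1 <= (1 - b) * M by rewrite mulrC -ler_pdivrMr ?subr_gt0.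
have Ge : (G + 1) * e ^+ 2 <= c2 / 2 by rewrite mulrC -ler_pdivlMr.
have M0 : 0 <= M by apply: le_trans hM; rewrite divr_ge0 ?subr_ge0 ?ltW.
have bal := evidence_balance b01 hs0 c10 c20 n0 GM Ge.
have EV A r := @expected_evidence_le _ _ _ _ _ _ P X eta lawX lawe indXe indZ
  _ _ F hF b s0 f0 b01 hs0 mf0 n Pif c1 c2 c10 near1 far1 A r n0.
have mA := measurable_renyi_ball (M * e ^+ 2).
set r := expR (- ((1 - b) * (M * e ^+ 2))) in bal.
have r01 : 0 <= r <= 1.
  rewrite expR_ge0/= expR_le1 oppr_le0 mulr_ge0 ?subr_ge0 ?(ltW b1)//.
  by rewrite mulr_ge0 ?sqr_ge0.
set k := (X in X / _ <= _) in bal; set t := (X in _ / X <= _) in bal.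
have t0 : 0 < t.
  apply: mulr_gt0; first by rewrite mulr_gt0 ?expR_gt0.
  apply: mulr_gt0; first exact: expR_gt0.
  by apply: divr_gt0; [rewrite divr_gt0|rewrite sqrtr_gt0 ltr0n].
have h1 : (\int[P]_w
    evidence X eta F b s0 f0 n Pif (~` renyi_ball (M * e ^+ 2)) w <= k%:E)%E.
  apply: EV => //; first exact: measurableC.
  by move=> th; rewrite renyi_ballE /= => /negP; rewrite -ltNge => /ltW.
have h2 : (\int[P]_w evidence X eta F b s0 f0 n Pif setT w < +oo)%E.
  apply: (le_lt_trans (EV setT 1 measurableT _ _)); last exact: ltry.
    by rewrite ler01 lexx.
  move=> th _; have [rt -> /andP[_ rt1]] := affinity_fin mu hF b01 hs0 mf0 th.
  by rewrite lee_fin.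
have h3 := evidence_lower lawX lawe indXe indZ hF b01 hs0 mf0 n0 mB
  (expR_gt0 _) hq hB.
apply: le_trans (expected_posterior_mass_ge hF mf0 mA t0 h2 h1 h3).
by rewrite lee_fin mulrDl mul1r; move: bal; rewrite -/C; lra.
Qed.

Variables (Pif : nat -> probability Theta R) (eps : nat -> R) (D : R).
Hypotheses (heps0 : eps n @[n --> \oo] --> (0 : R))
  (heps : (n%:R * eps n ^+ 2 : R) @[n --> \oo] --> +oo%R) (D0 : 0 < D).
Hypothesis mball : forall n, (0 < n)%N ->
  measurable [set th | (supnorm (F th \- f0)%R <= (eps n)%:E)%E].
Hypothesis hmass : forall n, (0 < n)%N ->
  ((expR (- (D * n%:R * eps n ^+ 2)))%:E
     <= Pif n [set th | (supnorm (F th \- f0)%R <= (eps n)%:E)%E])%E.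

Let supnorm_le (h : TX -> R) (x : R) :
  (supnorm h <= x%:E)%E -> forall y, `|h y| <= x.
Proof.
move=> hx y; rewrite -lee_fin; apply: le_trans hx.
by apply: ereal_sup_ubound; exists y.
Qed.

(** The error [C exp (- n eps ^ 2)] vanishes because [n eps ^ 2] tends to
    infinity. *)
Lemma renyi_contraction : exists2 M0 : R, 0 < M0 & forall M, M0 <= M ->
  forall h : R, 0 < h -> \forall n \near \oo,
  ((1 - h)%:E <= \int[P]_w (mass n (Pif n) (renyi_ball (M * eps n ^+ 2)) w)%:E)%E.
Proof.
have [M0 [C [e0 [M00 C0 e00 rate]]]] := expected_renyi_ball_ge D0.
exists M0 => // M hM h h0; near=> n.
have n0 : (0 < n)%N by near: n; exact: nbhs_infty_gt.
have en : `|eps n| <= Num.min 1 e0.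
  by near: n; apply: cvgr0_norm_le => //; rewrite lt_min ltr01.
have xn : C / h <= n%:R * eps n ^+ 2 by near: n; exact: cvgry_ge.
have e2 : eps n ^+ 2 <= e0.
  move: en; rewrite le_min => /andP[en1 ene].
  rewrite -real_normK ?num_real// expr2; apply: le_trans ene.
  by rewrite ler_piMr.
have hB th : (supnorm (F th \- f0)%R <= (eps n)%:E)%E ->
    forall x, (F th x - f0 x) ^+ 2 <= eps n ^+ 2.
  move=> /supnorm_le hle x; rewrite -real_normK ?num_real//.
  apply: lerXn2r; rewrite ?nnegrE//; last exact: hle.
  by apply: le_trans (hle x).
apply: le_trans (rate n (Pif n) (eps n) M _ n0 hM e2 (mball n0) hB (hmass n0)).
rewrite lee_fin lerD2l lerN2.
set x := n%:R * _ in xn *; have x0 : 0 < x by apply: lt_le_trans xn; rewrite divr_gt0.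
apply: (@le_trans _ _ (C / x)).
  rewrite ler_pM2l// expRN lef_pV2 ?posrE ?expR_gt0//.
  by apply: le_trans (expR_ge1Dx _); rewrite lerDr.
by rewrite ler_pdivrMr// mulrC -ler_pdivrMr.
Unshelve. all: by end_near. Qed.

(** Both the Renyi ball and the set of functions bounded by [K] carry most of
    the posterior mass, and their intersection is in an L2 ball. *)
Lemma L2_contraction (K : R) : (supnorm f0 < +oo)%E -> 0 < K ->
  measurable [set th | (supnorm (F th) <= K%:E)%E] ->
  (forall delta : R, 0 < delta ->
     P [set w | delta <=
       `|mass n (Pif n) [set th | (supnorm (F th) <= K%:E)%E] w - 1|]
     @[n --> \oo] --> 0%E) ->
  exists2 M0 : R, 0 < M0 & forall M, M0 <= M ->
  forall h : R, 0 < h -> \forall n \near \oo,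
  ((1 - h)%:E <= \int[P]_w (mass n (Pif n)
     [set th | (L2normsq mu (F th \- f0)%R <= (M * eps n ^+ 2)%:E)%E] w)%:E)%E.
Proof.
move=> hf0 K0 mB hB.
have [K1 K10 hK1] : exists2 K1 : R, 0 <= K1 & forall x, `|f0 x| <= K1.
  exists (Num.max 0 (fine (supnorm f0))) => [|x]; first by rewrite le_max lexx.
  have : (`|f0 x|%:E <= supnorm f0)%E by apply: ereal_sup_ubound; exists x.
  move: hf0; case: (supnorm f0) => [s| |]//= _; rewrite lee_fin => fs.
  by rewrite le_max fs orbT.
have KK0 : 0 <= K + K1 by rewrite addr_ge0// ltW.
have [c c0 hc] := L2normsq_le_renyi KK0.
have [M0 M00 hM0] := renyi_contraction.
exists (c * M0) => [|M hM h h0]; first by rewrite mulr_gt0.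
have hMc : M0 <= M / c by rewrite ler_pdivlMr// mulrC.
have h30 : 0 < h / 3 by rewrite divr_gt0.
near=> n.
have hA : ((1 - h / 3)%:E <= \int[P]_w
    (mass n (Pif n) (renyi_ball (M / c * eps n ^+ 2)) w)%:E)%E.
  by near: n; exact: hM0.
have hP : (P [set w | (h / 3 <= `|mass n (Pif n)
    [set th | (supnorm (F th) <= K%:E)%E] w - 1|)%R] <= (h / 3)%:E)%E.
  by near: n; exact: cvg0_near_le (hB _ h30) _ h30.
have hS := @expected_posterior_mass_sub _ _ _ _ _ X eta _ _ F hF b s0 f0 mf0 n (Pif n)
  P (renyi_ball (M / c * eps n ^+ 2)) _
  [set th | (L2normsq mu (F th \- f0)%R <= (M * eps n ^+ 2)%:E)%E] (h / 3)
  (measurable_renyi_ball _) mB (measurable_sublevel _ measurable_L2normsq) _ (ltW h30).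
have {}hS := hS _.
have : ((1 - h / 3)%:E <= \int[P]_w (mass n (Pif n)
    [set th | (L2normsq mu (F th \- f0)%R <= (M * eps n ^+ 2)%:E)%E] w)%:E +
    (h / 3 + h / 3)%:E)%E.
  apply: (le_trans hA); apply: (le_trans (hS _)).
    move=> th [/= hR hF1]; apply: le_trans (hc th _ hR _) _.
      move=> y; apply: (le_trans (ler_normB _ _)); apply: lerD => //.
      exact: supnorm_le.
    by rewrite lee_fin mulrA (mulrC c) divfK// gt_eqF.
  by rewrite EFinD addeA; apply: leeD2l.
move=> hsum; apply: (@le_trans _ _ ((1 - h / 3)%:E - (h / 3 + h / 3)%:E)%E).
  by rewrite -EFinB lee_fin le_eqVlt; apply/orP; left; apply/eqP; field.
by rewrite leeBlDr.
Unshelve. all: by end_near. Qed.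

End RegressionContraction.
(** * Posterior contraction over the cube *)

Theorem proposition1
  (R : realType) (d : nat) (mu : probability (cube R d) R)
  (* data-generating probability space, design points and noises *)
  (dO : measure_display) (Omega : measurableType dO) (P : probability Omega R)
  (X : {mfun Omega >-> cube R d} ^nat)
  (eta : {mfun Omega >-> measurableTypeR R} ^nat)
  (hXeta : iid_design_noise P mu X eta)
  (* space of regression functions *)
  (dT : measure_display) (Theta : measurableType dT) (F : Theta -> cube R d -> R)
  (hF : measurable_fun setT (fun p : Theta * cube R d => F p.1 p.2))
  (* prior *)
  (b : R) (hb : 0 < b < 1)
  (Pif : nat -> probability Theta R)
  (pis : nat -> probability (measurableTypeR R) R)
  (hpis : forall n, is_Gamma ((1 - b) / 2 * n%:R + 1) b (pis n))
  (* true parameters *)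
  (f0 : cube R d -> R) (mf0 : measurable_fun setT f0)
  (hf0 : (supnorm f0 < +oo)%E)
  (s0 : R) (hs0 : 0 < s0)
  (* prior mass condition *)
  (eps : nat -> R) (heps0 : eps n @[n --> \oo] --> (0 : R))
  (heps : (n%:R * eps n ^+ 2 : R) @[n --> \oo] --> +oo%R)
  (D : R) (hD : 0 < D)
  (mball : forall n, (0 < n)%N ->
     measurable [set th | (supnorm (F th \- f0)%R <= (eps n)%:E)%E])
  (hmass : forall n, (0 < n)%N ->
     ((expR (- (D * n%:R * eps n ^+ 2)))%:E
        <= Pif n [set th | (supnorm (F th \- f0)%R <= (eps n)%:E)%E])%E) :
  let post n (w : Omega) (A : set Theta) : R :=
    posterior_f F (Pif n) (pis n) (sample X eta f0 s0 n w) A in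
  (exists2 M0 : R, 0 < M0 & forall M, M0 <= M ->
     'E_P[fun w => post n w
       [set th | (obs_renyi mu b (F th) (2 * s0)%R f0 (2 * s0)%R
                    <= (M * eps n ^+ 2)%:E)%E]]%E
     @[n --> \oo] --> 1%E)
  /\
  (forall K : R, 0 < K ->
     measurable [set th | (supnorm (F th) <= K%:E)%E] ->
     (forall delta : R, 0 < delta ->
        P [set w | delta <= `|post n w [set th | (supnorm (F th) <= K%:E)%E] - 1|]
        @[n --> \oo] --> 0%E) ->
     exists2 M0 : R, 0 < M0 & forall M, M0 <= M ->
       'E_P[fun w => post n w
         [set th | (L2normsq mu (F th \- f0)%R <= (M * eps n ^+ 2)%:E)%E]]%E
       @[n --> \oo] --> 1%E).
Proof.
have [lawX lawe indXe indZ] := hXeta.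
have postE n w A : measurable A ->
    posterior_f F (Pif n) (pis n) (sample X eta f0 s0 n w) A =
    posterior_mass X eta F b s0 f0 n (Pif n) A w.
  move=> mA; exact: (@posterior_evidence R _ (cube R d) _ Omega X eta _ Theta F
    hF b s0 f0 hb hs0 mf0 n (Pif n) (pis n) A w (hpis n) mA).
move=> post; split.
  have [M0 M00 HM] := renyi_contraction lawX lawe indXe indZ hF hb hs0 mf0
    heps0 heps hD mball hmass.
  exists M0 => // M hM.
  pose S n := renyi_ball mu F b s0 f0 (M * eps n ^+ 2).
  have mS n : measurable (S n) by exact: measurable_renyi_ball.
  rewrite (_ : (fun n => _) = fun n =>
      (\int[P]_w (posterior_mass X eta F b s0 f0 n (Pif n) (S n) w)%:E)%E).
    apply: cvg_to_1; last by move=> h h0; exact: HM.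
    by move=> n; rewrite expected_posterior_mass_ge0 expected_posterior_mass_le1.
  apply/funext => n; rewrite unlock; apply: eq_integral => w _.
  by congr (_%:E); exact: (postE n w _ (mS n)).
move=> K K0 mK hK.
have hK' delta : 0 < delta ->
    P [set w | delta <= `|posterior_mass X eta F b s0 f0 n (Pif n)
         [set th | (supnorm (F th) <= K%:E)%E] w - 1|] @[n --> \oo] --> 0%E.
  move=> d0; rewrite (_ : (fun n => _) = fun n => P [set w | delta <= `|post n w
      [set th | (supnorm (F th) <= K%:E)%E] - 1|]); first exact: hK.
  apply/funext => n; have pE := funext (fun w => postE n w _ mK).
  exact: (congr1 (fun g : Omega -> R => P [set w | delta <= `|g w - 1|]) (esym pE)).
have [M0 M00 HM] := L2_contraction lawX lawe indXe indZ hF hb hs0 mf0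
  heps0 heps hD mball hmass hf0 K0 mK hK'.
exists M0 => // M hM.
pose S n := [set th | (L2normsq mu (F th \- f0)%R <= (M * eps n ^+ 2)%:E)%E].
have mS n : measurable (S n).
  by apply: measurable_sublevel; exact: measurable_L2normsq.
rewrite (_ : (fun n => _) = fun n =>
    (\int[P]_w (posterior_mass X eta F b s0 f0 n (Pif n) (S n) w)%:E)%E).
  apply: cvg_to_1; last by move=> h h0; exact: HM.
  by move=> n; rewrite expected_posterior_mass_ge0 expected_posterior_mass_le1.
apply/funext => n; rewrite unlock; apply: eq_integral => w _.
by congr (_%:E); exact: (postE n w _ (mS n)).
Qed.
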